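(* Let $\mathcal{D}\subset\mathbb{C}$ be a bounded connected domain with unit diameter. Assume that $f$ is meromorphic in $\mathcal{D}$ and holomorphic in a neighborhood of $\partial\mathcal{D}$, with (distinct) poles $\lambda_1,\dots,\lambda_s$ of multiplicities $m_{1,1},\dots,m_{s,1}$, respectively. Given $\epsilon>0$, let $$\Lambda_i(\epsilon):=\{z\in\mathcal{D}\mid|z-\lambda_i|\le\epsilon^{1/m_{i,1}}\}.$$ Let $\widetilde m=\sum_{i=1}^s m_{i,1}$ and let $r_n\in\mathcal{R}_{n,\widetilde m_n}$ be a sequence of rational functions satisfying $$\|f-r_n\|_{\partial\mathcal{D}}\le\gamma_n,\qquad\lim_{n\to\infty}\gamma_n=0,\qquad\widetilde m_n\le\widetilde m.$$ Then there exist $\epsilon_0>0$ and $C>0$, independent of $n$ and $\epsilon$, such that, for every $0<\epsilon\le\epsilon_0$ and every $n$ satisfying $\gamma_n\le C^{-1}\epsilon$, the function $r_n$ contains exactly $m_{i,1}$ poles in $\Lambda_i(\epsilon)$ (for each $1\le i\le s$).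
   Context: The diameter of $\mathcal{D}$ is the maximal distance (supremum of distances) between two points of $\mathcal{D}$. $\|g\|_{\partial\mathcal{D}}$ is the supremum norm of $g$ on $\partial\mathcal{D}$. $\mathcal{R}_{n,\widetilde m_n}$ denotes the set of rational functions with relatively prime numerator and denominator, having at most $n$ zeros and at most $\widetilde m_n$ poles in $\mathcal{D}$, counted with multiplicity. Numbers of poles are counted with multiplicity. *)

(* Defs.v *)
From HB Require Import structures.
From mathcomp Require Import all_boot all_order all_algebra.
From mathcomp Require Import complex.
From mathcomp Require Import all_classical all_reals all_analysis.

Set Implicit Arguments.
Unset Strict Implicit.
Unset Printing Implicit Defensive.

Import Order.TTheory GRing.Theory Num.Theory.
Import numFieldNormedType.Exports.

Local Open Scope classical_set_scope.
Local Open Scope ring_scope.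
Local Open Scope complex_scope.

(* R[i] as a one-dimensional normed space over itself, so that [derivable f z 1]
   for f : R[i] -> R[i] is complex differentiability at z. *)
HB.instance Definition _ (R : realType) := PseudoPointedMetric.copy R[i] R[i]^o.
HB.instance Definition _ (R : realType) := GRing.ComAlgebra.copy R[i] R[i]^o.
HB.instance Definition _ (R : realType) := Vector.copy R[i] R[i]^o.
HB.instance Definition _ (R : realType) := NormedModule.copy R[i] R[i]^o.

(* The modulus as an element of R; the library's [`|z|] lives in R[i]. *)
Definition cabs (R : realType) (z : R[i]) : R := complex.Re `|z|.

Lemma cabsE (R : realType) (z : R[i]) : (cabs z)%:C = `|z|.
Proof. by rewrite /cabs normc_def. Qed.

Definition boundary (T : topologicalType) (A : set T) : set T :=
  closure A `\` interior A.

Definition domain (R : realType) (A : set R[i]) : Prop :=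
  [/\ A !=set0, open A & connected A].

Definition diameter (R : realType) (A : set R[i]) : \bar R :=
  ereal_sup [set (cabs (zw.1 - zw.2))%:E | zw in A `*` A].

(* Intended for open U. *)
Definition holomorphic_on (R : realType) (U : set R[i]) (f : R[i] -> R[i]) :=
  forall z, U z -> derivable f z 1.

Definition holomorphic_at (R : realType) (z : R[i]) (f : R[i] -> R[i]) :=
  exists2 U, open_nbhs z U & holomorphic_on U f.

(* Functions are total; the value of f at a pole is irrelevant. *)
Definition pole_of_order (R : realType) (f : R[i] -> R[i]) (a : R[i])
    (k : nat) : Prop :=
  (0 < k)%N /\
  exists g : R[i] -> R[i], [/\ holomorphic_at a g, g a != 0 &
    \forall z \near a^', f z = g z / (z - a) ^+ k].

Definition is_pole (R : realType) (f : R[i] -> R[i]) (a : R[i]) : Prop :=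
  exists k, pole_of_order f a k.

Definition meromorphic_on (R : realType) (D : set R[i]) (f : R[i] -> R[i]) :=
  forall z, D z -> holomorphic_at z f \/ is_pole f z.

Record ratfun (R : realType) := RatFun {
  rnum : {poly R[i]};
  rden : {poly R[i]};
  rden_neq0 : rden != 0;
  rcoprime : coprimep rnum rden }.

(* Meaningful where rden r does not vanish; elsewhere r has a pole. *)
Definition rateval (R : realType) (r : ratfun R) (z : R[i]) : R[i] :=
  (rnum r).[z] / (rden r).[z].

(* Number of roots of p in A, counted with multiplicity. Finite sum, since
   [mup z p] is nonzero only at the roots of p != 0; as [mup z 0 = 0], the zero
   polynomial is given no roots. *)
Definition nroots (R : realType) (p : {poly R[i]}) (A : set R[i]) : nat :=
  \big[addn/0%N]_(z \in A) mup z p.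

Definition nzeros (R : realType) (r : ratfun R) (A : set R[i]) : nat :=
  nroots (rnum r) A.

Definition npoles (R : realType) (r : ratfun R) (A : set R[i]) : nat :=
  nroots (rden r) A.

(* The class R_{n,k}, relative to D. The zero function belongs to it. *)
Definition ratclass (R : realType) (D : set R[i]) (n k : nat) : set (ratfun R) :=
  [set r | (nzeros r D <= n)%N /\ (npoles r D <= k)%N].

(* The sup norm of f - r on A. A pole of r contributes +oo; the case split
   matters at isolated points of A, where x / 0 = 0 would hide the pole. *)
Definition supnorm_diff (R : realType) (A : set R[i]) (f : R[i] -> R[i])
    (r : ratfun R) : \bar R :=
  ereal_sup [set (if (rden r).[z] == 0 then +oo%E
                  else (cabs (f z - rateval r z))%:E) | z in A].

(* Lambda_i(e), for a = lambda_i and k = m_{i,1}. *)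
Definition Lambda (R : realType) (D : set R[i]) (a : R[i]) (k : nat) (e : R) :
    set R[i] :=
  [set z | D z /\ cabs (z - a) <= e `^ (k%:R^-1)].

(* Main.v *)
(**
Let Q be the monic polynomial of the poles of r_n in D, q the polynomial of the
poles of f, F = f q and P = r_n Q. Then F Q - q P is holomorphic on D, and on the
boundary it is q Q (f - r_n), of modulus at most gamma_n because all factors
z - a are at most the diameter 1. By the maximum principle the bound holds on D.
Near lam_i, F is holomorphic and bounded below, so Q is within O(gamma_n) of a
multiple of (z - lam_i)^m_i; Newton interpolation then shows that Q mod q has
coefficients O(gamma_n). As Q is monic of degree at most deg q, this forces
Q = q + O(gamma_n). Hence |q| = O(gamma_n) at each root of Q, which places the
root in some Lambda_i; and each Lambda_i holds at least m_i roots, as one sees by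
comparing |Q| with |q| at a point at small fixed distance from lam_i.

The maximum principle for functions that are merely complex differentiable comes
from Goursat's bisection argument applied to the form h(z0 + rho e^w) dw on a
rectangle of width 2 pi, i.e. in polar coordinates around z0; with primitives in
place of integrals it yields the mean value inequality directly.
*)

Require Import Defs.
From HB Require Import structures.
From mathcomp Require Import all_boot all_order all_algebra.
From mathcomp Require Import complex.
From mathcomp Require Import all_classical all_reals all_analysis.
From mathcomp Require Import ring lra.

Set Implicit Arguments.
Unset Strict Implicit.
Unset Printing Implicit Defensive.

Import Order.TTheory GRing.Theory Num.Theory.
Import numFieldNormedType.Exports.

Local Open Scope classical_set_scope.
Local Open Scope ring_scope.
Local Open Scope complex_scope.

(** * Goursat's lemma for real closed forms *)

(** The integral from [a] is differentiable on both sides only at interior points, so users of this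
    lemma enlarge the interval by a margin. *)
Lemma continuous_primitive (R : realType) (f : R -> R) (a b : R) :
  continuous f -> exists F : R -> R,
    forall x, a < x -> x < b -> is_derive x 1 F (f x).
Proof.
move=> cf; exists (fun x => \int[lebesgue_measure]_(t in [set` `[a, x]]) f t)%R.
move=> x ax xb.
have [] := @continuous_FTC1_closed R f a x b xb _ ax (cf x).
  apply: (@continuous_compact_integrable R f `[a, b]).
    exact: segment_compact.
  exact: continuous_subspaceT.
by move=> d e; rewrite -e derive1E; exact: derivableP.
Qed.

Lemma primitive_increment (R : realType) (F f : R -> R) (a b : R) : a <= b ->
  (forall x, a <= x -> x <= b -> is_derive x 1 F (f x)) ->
  exists2 c, a <= c <= b & F b - F a = f c * (b - a).
Proof.
move=> ab dF.
have [x| |c] := @MVT_segment R F f a b ab.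
- by rewrite in_itv/= => /andP[/ltW ax /ltW xb]; exact: dF.
- apply: derivable_within_continuous => x; rewrite in_itv/= => /andP[ax xb].
  by have := dF x ax xb => -[].
- by rewrite in_itv/= => cab ->; exists c.
Qed.

Lemma nested_segments (R : realType) (l r : nat -> R) :
  (forall n, l n <= l n.+1) -> (forall n, r n.+1 <= r n) ->
  (forall n, l n <= r n) -> exists x, forall n, l n <= x <= r n.
Proof.
move=> lS rS lr.
have ndl : {homo l : n k / (n <= k)%N >-> n <= k} by exact/nondecreasing_seqP.
have nir : {homo r : n k / (n <= k)%N >-> k <= n}.
  by move=> n k; move: n k; apply/nonincreasing_seqP.
have lrnk n k : l n <= r k.
  have [nk|/ltnW kn] := leqP n k; first exact: le_trans (ndl _ _ nk) (lr k).
  exact: le_trans (lr n) (nir _ _ kn).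
exists (sup (range l)) => n; apply/andP; split.
  apply: ub_le_sup; last by exists n.
  by exists (r 0%N) => _ [k _ <-].
by apply: ge_sup; [exists (l 0%N); exists 0%N | move=> _ [k _ <-]].
Qed.

(** [Bad x y t] speaks of the rectangle with lower left corner [(x, y)] and sides [w * t], [v * t].
    Halving both sides forever yields nested bad rectangles, and [(p, q)] is a point common to all
    of them. *)
Lemma quadrisection (R : realType) (Bad : R -> R -> R -> Prop) (w v x0 y0 : R) :
  0 <= w -> 0 <= v ->
  (forall x y t, 0 < t -> Bad x y t -> exists i j : bool,
     Bad (x + i%:R * (w * (t / 2))) (y + j%:R * (v * (t / 2))) (t / 2)) ->
  Bad x0 y0 1 ->
  exists p q : R, forall n : nat, exists x y : R, let t := 2^-1 ^+ n in
    [/\ Bad x y t, x <= p <= x + w * t, y <= q <= y + v * t,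
        x0 <= x /\ x + w * t <= x0 + w & y0 <= y /\ y + v * t <= y0 + v].
Proof.
move=> w0 v0 H B0.
pose t n : R := 2^-1 ^+ n.
have t0 n : 0 < t n by rewrite exprn_gt0// invr_gt0.
have tS n : t n.+1 = t n / 2 by rewrite /t exprSr.
(* A state is a bad rectangle together with its depth, from which the scale [t] is recovered along
   the chain given by dependent choice. *)
pose S := {z : R * R * nat | Bad z.1.1 z.1.2 (t z.2)}.
pose Rel (a b : S) := exists i j : bool,
  [/\ (sval b).2 = (sval a).2.+1, (sval b).1.1 = (sval a).1.1 + i%:R * (w * t (sval a).2.+1) &
   (sval b).1.2 = (sval a).1.2 + j%:R * (v * t (sval a).2.+1)].
have RelP a : {b | Rel a b}.
  apply: cid; case: a => -[[x y] n] /= ba.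
  have [i [j B]] := H _ _ _ (t0 n) ba.
  rewrite -tS in B.
  by exists (exist _ (_, _, n.+1) B), i, j.
have [F [F0 FS]] := dependent_choice RelP
  (exist (fun z : R * R * nat => Bad z.1.1 z.1.2 (t z.2)) (x0, y0, 0%N) B0).
have Fn n : (sval (F n)).2 = n.
  elim: n => [|n IH]; first by rewrite F0.
  by have [i [j [-> _ _]]] := FS n; rewrite IH.
pose X n := (sval (F n)).1.1; pose Y n := (sval (F n)).1.2.
have BXY n : Bad (X n) (Y n) (t n) by have := svalP (F n); rewrite Fn.
have XS n : exists i : bool, X n.+1 = X n + i%:R * (w * t n.+1).
  by have [i [j [_ E _]]] := FS n; exists i; rewrite /X E Fn.
have YS n : exists i : bool, Y n.+1 = Y n + i%:R * (v * t n.+1).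
  by have [i [j [_ _ E]]] := FS n; exists j; rewrite /Y E Fn.
have nest (Z : nat -> R) u : 0 <= u ->
    (forall n, exists i : bool, Z n.+1 = Z n + i%:R * (u * t n.+1)) ->
  [/\ (forall n, Z n <= Z n.+1), (forall n, Z n.+1 + u * t n.+1 <= Z n + u * t n) &
    forall n, Z n <= Z n + u * t n].
  move=> u0 ZS; split=> n; last by rewrite lerDl mulr_ge0// ltW.
    by have [i ->] := ZS n; rewrite lerDl mulr_ge0// mulr_ge0// ltW.
  have [i ->] := ZS n; rewrite tS.
  have : 0 <= u * t n by rewrite mulr_ge0// ltW.
  by case: i => /=; lra.
have [X1 X2 X3] := nest X w w0 XS.
have [Y1 Y2 Y3] := nest Y v v0 YS.
have [p Hp] := nested_segments X1 X2 X3.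
have [q Hq] := nested_segments Y1 Y2 Y3.
have bnd (Z : nat -> R) u : (forall n, Z n <= Z n.+1) ->
   (forall n, Z n.+1 + u * t n.+1 <= Z n + u * t n) ->
  forall n, Z 0%N <= Z n /\ Z n + u * t n <= Z 0%N + u.
  move=> Z1 Z2; elim=> [|n [IH1 IH2]]; first by rewrite /t expr0 mulr1.
  by split; [exact: le_trans IH1 (Z1 n)|exact: le_trans (Z2 n) IH2].
have X00 : X 0%N = x0 by rewrite /X F0.
have Y00 : Y 0%N = y0 by rewrite /Y F0.
exists p, q => n; exists (X n), (Y n); split => //.
  by rewrite -X00; exact: bnd.
by rewrite -Y00; exact: bnd.
Qed.

(** When [A] is a primitive of [Q] in the first variable and [B] one of [P] in the second, this is
    the counterclockwise integral of [Q dx + P dy] around the rectangle with corner [(x, y)] and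
    sides [u], [k]. *)
Definition circulation (R : realType) (A B : R -> R -> R) (x y u k : R) : R :=
  (A (x + u) y - A x y) - (A (x + u) (y + k) - A x (y + k)) +
  ((B (x + u) (y + k) - B (x + u) y) - (B x (y + k) - B x y)).

Section Goursat.
Variables (R : realType) (P Q A B : R -> R -> R) (x0 y0 w v : R).
Hypotheses (w0 : 0 < w) (v0 : 0 < v).

Let rect x y := [/\ x0 <= x, x <= x0 + w, y0 <= y & y <= y0 + v].

Hypothesis dA : forall x y, rect x y -> is_derive x 1 (A^~ y) (Q x y).
Hypothesis dB : forall x y, rect x y -> is_derive y 1 (B x) (P x y).

(** The coefficient [a] occurs twice: it is both the x-derivative of [P] and the y-derivative of
    [Q], which makes the form [Q dx + P dy] closed at the point. *)
Definition linearized (e d x y a b c : R) := forall x' y', rect x' y' ->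
  `|x' - x| < d -> `|y' - y| < d ->
  `|P x' y' - P x y - a * (x' - x) - b * (y' - y)| <= e * (`|x' - x| + `|y' - y|)
  /\ `|Q x' y' - Q x y - c * (x' - x) - a * (y' - y)| <= e * (`|x' - x| + `|y' - y|).

(** The affine parts of [P] and [Q] contribute nothing to the circulation, because they share [a];
    only errors of order [e * (u + k)] remain, multiplied by the side lengths. *)
Lemma circulation_small (e d p q a b c x y u k : R) :
  linearized e d p q a b c -> 0 <= e -> 0 <= u -> 0 <= k ->
  x0 <= x -> x + u <= x0 + w -> y0 <= y -> y + k <= y0 + v ->
  x <= p <= x + u -> y <= q <= y + k -> u < d -> k < d ->
  `|circulation A B x y u k| <= 2 * e * (u + k) ^+ 2.
Proof.
move=> L e0 u0 k0 xx xw yy yv /andP[xp px] /andP[yq qy] ud kd.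
have near1 s : x <= s -> s <= x + u -> `|s - p| <= u by move=> *; rewrite ler_norml; lra.
have near2 s : y <= s -> s <= y + k -> `|s - q| <= k by move=> *; rewrite ler_norml; lra.
have E s z : x <= s -> s <= x + u -> y <= z -> z <= y + k ->
  `|P s z - P p q - a * (s - p) - b * (z - q)| <= e * (u + k) /\
  `|Q s z - Q p q - c * (s - p) - a * (z - q)| <= e * (u + k).
  move=> s1 s2 z1 z2.
  have n1 := near1 _ s1 s2; have n2 := near2 _ z1 z2.
  have [|||L1 L2] := L s z; [split; lra|lra|lra|].
  have : e * (`|s - p| + `|z - q|) <= e * (u + k) by rewrite ler_wpM2l// lerD.
  by split; lra.
have [||xi /andP[xi1 xi2] EA] := @primitive_increment R (fun t => A t y - A t (y + k))
   (fun t => Q t y - Q t (y + k)) x (x + u).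
- by lra.
- move=> t t1 t2; apply: is_deriveB; apply: dA; split; lra.
have [||et /andP[et1 et2] EB] := @primitive_increment R (fun t => B (x + u) t - B x t)
   (fun t => P (x + u) t - P x t) y (y + k).
- by lra.
- move=> t t1 t2; apply: is_deriveB; apply: dB; split; lra.
(* The mean value theorem is applied to differences of opposite sides, so that both values are taken
   at the same [xi] (or [et]) and the terms in [c] and [b] cancel. The two corrections [a * k * u]
   cancel each other. *)
have -> : circulation A B x y u k =
    (Q xi y - Q xi (y + k) + a * k) * u + (P (x + u) et - P x et - a * u) * k.
  have -> : (Q xi y - Q xi (y + k) + a * k) * u =
     (Q xi y - Q xi (y + k)) * (x + u - x) + a * k * u by ring.
  have -> : (P (x + u) et - P x et - a * u) * k =
     (P (x + u) et - P x et) * (y + k - y) - a * k * u by ring.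
  by rewrite -EA -EB /circulation; ring.
have [_ Q1] := E xi y xi1 xi2 (lexx _) ltac:(lra).
have [_ Q2] := E xi (y + k) xi1 xi2 ltac:(lra) (lexx _).
have [P1 _] := E (x + u) et ltac:(lra) (lexx _) et1 et2.
have [P2 _] := E x et (lexx _) ltac:(lra) et1 et2.
have b1 : `|Q xi y - Q xi (y + k) + a * k| <= 2 * e * (u + k).
  by move: Q1 Q2; rewrite !ler_norml => /andP[? ?] /andP[? ?]; lra.
have b2 : `|P (x + u) et - P x et - a * u| <= 2 * e * (u + k).
  by move: P1 P2; rewrite !ler_norml => /andP[? ?] /andP[? ?]; lra.
rewrite (le_trans (ler_normD _ _))// !normrM (ger0_norm u0) (ger0_norm k0).
have := ler_wpM2r u0 b1; have := ler_wpM2r k0 b2.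
have -> : 2 * e * (u + k) ^+ 2 = 2 * e * (u + k) * u + 2 * e * (u + k) * k by ring.
by lra.
Qed.

(** Circulation is additive under cutting into four, so a nonzero total leaves, at every scale [t],
    a rectangle with at least the share [t ^+ 2] of it. Near the limit point this contradicts
    [circulation_small]. *)
Lemma goursat_rectangle :
  (forall x y, rect x y -> exists a b c, forall e, 0 < e ->
     exists2 d, 0 < d & linearized e d x y a b c) ->
  circulation A B x0 y0 w v = 0.
Proof.
move=> L; set J := circulation A B x0 y0 w v.
apply/eqP/negPn/negP => J0.
pose Bad x y t := `|J| * t ^+ 2 <= `|circulation A B x y (w * t) (v * t)|.
have [||p [q H]] := @quadrisection R Bad w v x0 y0 (ltW w0) (ltW v0).
- move=> x y t t0 bt.
  have S4 : circulation A B x y (w * t) (v * t) =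
     circulation A B x y (w * (t / 2)) (v * (t / 2)) +
     circulation A B (x + w * (t / 2)) y (w * (t / 2)) (v * (t / 2)) +
     circulation A B x (y + v * (t / 2)) (w * (t / 2)) (v * (t / 2)) +
     circulation A B (x + w * (t / 2)) (y + v * (t / 2)) (w * (t / 2)) (v * (t / 2)).
    rewrite /circulation.
    have -> : x + w * (t / 2) + w * (t / 2) = x + w * t by field.
    have -> : y + v * (t / 2) + v * (t / 2) = y + v * t by field.
    by ring.
  apply: contrapT => N.
  have {}N (i j : bool) : `|circulation A B (x + i%:R * (w * (t / 2)))
      (y + j%:R * (v * (t / 2))) (w * (t / 2)) (v * (t / 2))| < `|J| * (t / 2) ^+ 2.
    by rewrite ltNge; apply/negP => ?; apply: N; exists i, j.
  have := N false false; have := N false true; have := N true false; have := N true true.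
  rewrite /= !mul1r !mul0r !addr0 => N1 N2 N3 N4.
  have E4 : `|J| * t ^+ 2 = 4 * (`|J| * (t / 2) ^+ 2) by field.
  move: bt; rewrite /Bad S4 E4 leNgt => /negP; apply.
  do 3 (rewrite (le_lt_trans (ler_normD _ _))// -ltrBrDr).
  by lra.
- by rewrite /Bad expr1n !mulr1.
have rpq : rect p q.
  have [x [y [_ /andP[? ?] /andP[? ?] [? ?] [? ?]]]] := H 0%N.
  by split; lra.
have [a [b [c Labc]]] := L p q rpq.
have wv0 : 0 < 2 * (w + v) ^+ 2 by rewrite mulr_gt0// exprn_gt0// addr_gt0.
(* With this [e] the bound of [circulation_small] at scale [t] is exactly half of the share
   [|J| * t ^+ 2]. *)
pose e := `|J| / (2 * (w + v) ^+ 2) / 2.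
have e0 : 0 < e by rewrite !divr_gt0// normr_gt0.
have [d d0 Ld] := Labc e e0.
have [n Hn] : exists n : nat, (2^-1 ^+ n : R) * (w + v) < d.
  have : (fun n => (2^-1 : R) ^+ n) @ \oo --> (0 : R).
    by apply: cvg_expr; rewrite ger0_norm ?invr_ge0// invf_lt1// ltr1n.
  move=> /cvgrPdist_lt/(_ (d / (w + v))) [|n _ /(_ n (leqnn n))].
    by rewrite divr_gt0// addr_gt0.
  rewrite /= sub0r normrN ger0_norm ?exprn_ge0 ?invr_ge0// ltr_pdivlMr ?addr_gt0//.
  by exists n.
have [x [y /=]] := H n; set t : R := 2^-1 ^+ n in Hn *; move=> [bt px qy [? ?] [? ?]].
have t0 : 0 < t by rewrite exprn_gt0// invr_gt0.
have wt := mulr_gt0 w0 t0; have vt := mulr_gt0 v0 t0.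
have := @circulation_small e d p q a b c x y (w * t) (v * t) Ld (ltW e0) (ltW wt) (ltW vt).
move=> /(_ ltac:(by []) ltac:(by []) ltac:(by []) ltac:(by []) px qy).
move=> /(_ ltac:(lra) ltac:(lra)).
move=> /(le_trans bt).
have -> : 2 * e * (w * t + v * t) ^+ 2 = `|J| / 2 * t ^+ 2.
  by rewrite /e; field; rewrite gt_eqF// addr_gt0.
have Jp : 0 < `|J| by rewrite normr_gt0.
by rewrite ler_pM2r ?exprn_gt0// => ?; lra.
Qed.
End Goursat.

(** * Complex differentiability *)

Import Normc.

(* Equivalent to [derivable f z 1]; a definition that does not unfold to filters
   keeps unification on R[i] from diverging. *)
Definition cdiff (R : realType) (f : R[i] -> R[i]) (z : R[i]) : Prop :=
  exists b, forall e, 0 < e -> exists2 d : R, 0 < d & forall t, cabs t < d ->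
    cabs (f (z + t) - f z - b * t) <= e * cabs t.

Section Modulus.
Variable R : realType.
Implicit Types z w : R[i].

Lemma cabs_normc z : cabs z = normc z.
Proof. by rewrite /cabs normc_def /=; case: z. Qed.

Lemma cabs_ge0 z : 0 <= cabs z.
Proof. by rewrite cabs_normc; case: z => a b; exact: sqrtr_ge0. Qed.

Lemma cabs0 : cabs (0 : R[i]) = 0.
Proof. by rewrite cabs_normc normc0. Qed.

Lemma cabs1 : cabs (1 : R[i]) = 1.
Proof. by rewrite cabs_normc normc1. Qed.

Lemma cabsM z w : cabs (z * w) = cabs z * cabs w.
Proof. by rewrite !cabs_normc normcM. Qed.

Lemma cabsV z : cabs z^-1 = (cabs z)^-1.
Proof. by rewrite !cabs_normc normcV. Qed.

Lemma cabsX z n : cabs (z ^+ n) = cabs z ^+ n.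
Proof. by elim: n => [|n IH]; rewrite ?expr0 ?cabs1// !exprS cabsM IH. Qed.

Lemma cabs_prod (I : Type) (r : seq I) (P : pred I) (F : I -> R[i]) :
  cabs (\prod_(i <- r | P i) F i) = \prod_(i <- r | P i) cabs (F i).
Proof. by apply: (big_morph _ cabsM cabs1). Qed.

Lemma cabsN z : cabs (- z) = cabs z.
Proof. by rewrite /cabs normrN. Qed.

Lemma cabsBC z w : cabs (z - w) = cabs (w - z).
Proof. by rewrite /cabs distrC. Qed.

Lemma cabsD z w : cabs (z + w) <= cabs z + cabs w.
Proof. by rewrite !cabs_normc le_normcD. Qed.

Lemma cabsB z w : cabs (z - w) <= cabs z + cabs w.
Proof. by rewrite -(cabsN w) cabsD. Qed.

Lemma cabs_eq0 z : (cabs z == 0) = (z == 0).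
Proof.
apply/eqP/eqP => [|->]; last exact: cabs0.
by rewrite cabs_normc => /eq0_normc.
Qed.

Lemma cabs_gt0 z : (0 < cabs z) = (z != 0).
Proof. by rewrite lt0r cabs_eq0 cabs_ge0 andbT. Qed.

Lemma cabsR (x : R) : cabs x%:C = `|x|.
Proof. by rewrite cabs_normc /= expr0n addr0 sqrtr_sqr. Qed.

Lemma Re_le_cabs z : `|complex.Re z| <= cabs z.
Proof.
rewrite cabs_normc; case: z => a b /=.
by rewrite -sqrtr_sqr ler_wsqrtr// lerDl sqr_ge0.
Qed.

Lemma Im_le_cabs z : `|complex.Im z| <= cabs z.
Proof.
rewrite cabs_normc; case: z => a b /=.
by rewrite -sqrtr_sqr ler_wsqrtr// lerDr sqr_ge0.
Qed.

Lemma cabs_leD (a b : R) : cabs (a +i* b) <= `|a| + `|b|.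
Proof.
rewrite cabs_normc /= -[leRHS]ger0_norm ?addr_ge0// -sqrtr_sqr ler_wsqrtr//.
rewrite sqrrD !real_normK ?num_real// addrAC lerDl.
by rewrite mulrn_wge0// mulr_ge0.
Qed.

Lemma sqr_cabs z : cabs z ^+ 2 = complex.Re z ^+ 2 + complex.Im z ^+ 2.
Proof.
rewrite cabs_normc; case: z => a b /=.
by rewrite sqr_sqrtr// addr_ge0// sqr_ge0.
Qed.

Lemma ReD z w : complex.Re (z + w) = complex.Re z + complex.Re w.
Proof. by case: z w => [? ?] [? ?]. Qed.

(** Radii of balls in [R[i]] are themselves elements of [R[i]]; positivity makes them real, which
    allows real radii throughout. *)
Lemma nbhs_cabsP z (U : set R[i]) :
  nbhs z U <-> exists2 d : R, 0 < d & forall w, cabs (w - z) < d -> U w.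
Proof.
rewrite -nbhs_ballE; split=> -[d d0 dU].
  have /complex_realP[k dk] : d \is Num.real by exact: gtr0_real.
  exists k; first by rewrite -ltcR -dk.
  move=> w wz; apply: dU; rewrite -ball_normE /ball_/=.
  by rewrite dk distrC -cabsE ltcR.
exists d%:C; first by rewrite /= ltcR.
move=> w; rewrite -ball_normE /ball_/= distrC -cabsE ltcR; exact: dU.
Qed.

Lemma continuous_cabsP (f : R[i] -> R[i]) z : {for z, continuous f} <->
  forall e, 0 < e -> exists2 d : R, 0 < d &
    forall w, cabs (w - z) < d -> cabs (f w - f z) < e.
Proof.
split=> [cf e e0|H U /nbhs_cabsP[e e0 eU]].
  have /cf/nbhs_cabsP : nbhs (f z) [set w | cabs (w - f z) < e].
    by apply/nbhs_cabsP; exists e.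
  by [].
by have [d d0 dH] := H e e0; apply/nbhs_cabsP; exists d => // w /dH/eU.
Qed.

Lemma cdiffP (f : R[i] -> R[i]) z : cdiff f z <-> derivable f z 1.
Proof.
split=> [[b H]|/cvg_ex[b /= fb]].
  apply/cvg_ex; exists b => U /nbhs_cabsP[e e0 eU].
  have [d d0 dH] := H (e / 2) ltac:(by rewrite divr_gt0).
  apply/nbhs_cabsP; exists d => // t; rewrite subr0 => td t0; apply: eU.
  rewrite /GRing.scale/= mulr1.
  have -> : t^-1 * (f (t + z) - f z) - b = t^-1 * (f (z + t) - f z - b * t).
    rewrite [z + t]addrC [RHS]mulrBr; congr (_ - _); by rewrite mulrCA mulVf// mulr1.
  rewrite cabsM cabsV mulrC ltr_pdivrMr ?cabs_gt0//.
  by rewrite (le_lt_trans (dH t td))// ltr_pM2r ?cabs_gt0// ltr_pdivrMr// ltr_pMr// ltr1n.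
exists b => e e0.
have /fb : nbhs b [set w | cabs (w - b) < e] by apply/nbhs_cabsP; exists e.
move=> /nbhs_cabsP[d d0 dH]; exists d => // t td.
have [->|t0] := eqVneq t 0; first by rewrite addr0 subrr mulr0 subr0 cabs0 mulr0.
have := dH t; rewrite subr0 => /(_ td t0) /=.
rewrite /GRing.scale/= mulr1 => /ltW H.
have -> : f (z + t) - f z - b * t = (t^-1 * (f (t + z) - f z) - b) * t.
  by rewrite mulrBl mulrAC mulVf// mul1r [t + z]addrC.
by rewrite cabsM ler_wpM2r// cabs_ge0.
Qed.

Lemma derivable_continuous (f : R[i] -> R[i]) z :
  derivable f z 1 -> {for z, continuous f}.
Proof. by move=> df; apply: differentiable_continuous; exact/derivable1_diffP. Qed.

End Modulus.

Section ComplexDerivable.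
Variable R : realType.
Implicit Types (f g : R[i] -> R[i]) (z : R[i]).

Lemma cdiffD f g z : cdiff f z -> cdiff g z -> cdiff (fun x => f x + g x) z.
Proof.
move=> /cdiffP df /cdiffP dg; apply/cdiffP.
exact: (@derivableD R[i] R[i] R[i] f g z 1 df dg).
Qed.

Lemma cdiffB f g z : cdiff f z -> cdiff g z -> cdiff (fun x => f x - g x) z.
Proof.
move=> /cdiffP df /cdiffP dg; apply/cdiffP.
exact: (@derivableB R[i] R[i] R[i] f g z 1 df dg).
Qed.

Lemma cdiffM f g z : cdiff f z -> cdiff g z -> cdiff (fun x => f x * g x) z.
Proof.
move=> /cdiffP df /cdiffP dg; apply/cdiffP.
exact: (@derivableM R[i] R[i] f g z 1 df dg).
Qed.

Lemma cdiffV f z : f z != 0 -> cdiff f z -> cdiff (fun x => (f x)^-1) z.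
Proof. by move=> fz /cdiffP df; apply/cdiffP; exact: (@derivableV R[i] R[i] f z 1 fz df). Qed.

Lemma cdiff_id z : cdiff (fun x : R[i] => x) z.
Proof. by apply/cdiffP; exact: derivable_id. Qed.

Lemma cdiff_cst (c z : R[i]) : cdiff (fun=> c) z.
Proof. by apply/cdiffP; exact: derivable_cst. Qed.

Lemma cdiff_horner (p : {poly R[i]}) z : cdiff (horner p) z.
Proof.
elim/poly_ind: p => [|p c IH].
  rewrite (_ : horner 0 = fun=> 0); first exact: cdiff_cst.
  by apply/funext => x; rewrite horner0.
rewrite (_ : horner _ = (fun x => p.[x] * x + c)); last first.
  by apply/funext => x; rewrite hornerMXaddC.
apply: cdiffD; last exact: cdiff_cst.
by apply: cdiffM => //; exact: cdiff_id.
Qed.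

Lemma cdiff_near f g z : (\forall x \near z, f x = g x) ->
  cdiff f z -> cdiff g z.
Proof.
move=> /nbhs_cabsP[d d0 fg] [b Hb].
exists b => e e0; have [d' d'0 H] := Hb e e0.
exists (Num.min d d'); first by rewrite lt_min d0.
move=> t; rewrite lt_min => /andP[td td'].
rewrite -!fg; first exact: H.
  by rewrite subrr cabs0.
by rewrite addrAC subrr add0r.
Qed.

End ComplexDerivable.

(** * The complex exponential and its derivative *)

Section ComplexExponential.
Variable R : realType.

Lemma Re_continuous : continuous (@complex.Re R : R[i] -> R).
Proof.
move=> z U /nbhs_ballP[e /= e0 eU]; apply/nbhs_cabsP; exists e => // w wz.
apply: eU; rewrite -ball_normE /ball_/=.
apply: le_lt_trans wz; rewrite distrC.
by apply: le_trans (Re_le_cabs (w - z)); case: (w) (z) => [? ?] [? ?].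
Qed.

Lemma Im_continuous : continuous (@complex.Im R : R[i] -> R).
Proof.
move=> z U /nbhs_ballP[e /= e0 eU]; apply/nbhs_cabsP; exists e => // w wz.
apply: eU; rewrite -ball_normE /ball_/=.
apply: le_lt_trans wz; rewrite distrC.
by apply: le_trans (Im_le_cabs (w - z)); case: (w) (z) => [? ?] [? ?].
Qed.

Lemma Complex_continuous : continuous (fun p : R * R => p.1 +i* p.2).
Proof.
move=> [a b] U /nbhs_cabsP[e e0 eU].
exists (ball a (e / 2), ball b (e / 2)) => /=.
  by split; apply: nbhsx_ballx; rewrite divr_gt0.
move=> [x y] [/= ax byy]; apply: eU => /=.
move: ax byy; rewrite -!ball_normE /ball_/= => ax byy.
have -> : (x +i* y) - (a +i* b) = (x - a) +i* (y - b) by [].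
by rewrite (le_lt_trans (cabs_leD _ _))// [ltRHS]splitr ltrD// distrC.
Qed.

Lemma is_derive_linearize (f : R -> R) (x l : R) : is_derive x 1 f l ->
  forall e, 0 < e -> exists2 d, 0 < d & forall t, `|t| < d ->
    `|f (x + t) - f x - l * t| <= e * `|t|.
Proof.
move=> [/cvg_ex[b fb] lb] e e0.
have {}lb : b = l by rewrite -lb /derive; apply/esym/cvg_lim.
rewrite {}lb in fb.
have /fb : nbhs l (ball l e) by exact: nbhsx_ballx.
move=> /nbhs_ballP[d /= d0 dH]; exists d => // t td.
have [->|t0] := eqVneq t 0; first by rewrite addr0 subrr mulr0 subr0 normr0 mulr0.
have := dH t; rewrite -!ball_normE /ball_/= sub0r normrN => /(_ td t0) /=.
rewrite /GRing.scale/= mulr1 distrC => /ltW H.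
have -> : f (x + t) - f x - l * t = (t^-1 * (f (t + x) - f x) - l) * t.
  by rewrite mulrBl mulrAC mulVf// mul1r [t + x]addrC.
by rewrite normrM ler_wpM2r.
Qed.

Definition cexp (w : R[i]) : R[i] :=
  (expR (complex.Re w) * cos (complex.Im w)) +i*
  (expR (complex.Re w) * sin (complex.Im w)).

Lemma cexpD w t : cexp (w + t) = cexp w * cexp t.
Proof.
case: w t => [a b] [c d]; rewrite /cexp/= expRD cosD sinD.
by apply/eqP; rewrite eq_complex/=; apply/andP; split; apply/eqP; ring.
Qed.

Lemma cabs_cexp w : cabs (cexp w) = expR (complex.Re w).
Proof.
rewrite -[RHS]ger0_norm ?expR_ge0// -[RHS]sqrtr_sqr.
rewrite -[LHS]ger0_norm ?cabs_ge0// -[LHS]sqrtr_sqr; congr Num.sqrt.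
by rewrite sqr_cabs /= !exprMn -mulrDr cos2Dsin2 mulr1.
Qed.

(** By the addition formula only [cexp t - 1 - t] near 0 matters, and this follows from the
    first-order expansions of [expR], [cos] and [sin] at 0. *)
Lemma derivable_cexp w : derivable cexp w 1.
Proof.
apply/cdiffP; exists (cexp w) => e e0.
pose C := cabs (cexp w); have C0 : 0 < C by rewrite /C cabs_cexp expR_gt0.
(* The real part of the remainder will cost [3 * k * T] and the imaginary part [4 * k * T], whence
   7. *)
pose k := e / C / 7.
have k0 : 0 < k by rewrite !divr_gt0.
have [d1 d10 H1] := is_derive_linearize (is_derive_expR (0 : R)) k0.
have [d2 d20 H2] := is_derive_linearize (is_derive_cos (0 : R)) k0.
have [d3 d30 H3] := is_derive_linearize (is_derive_sin (0 : R)) k0.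
(* This cruder expansion, with error at most [|a|], gives [expR a <= 2] and [|expR a - 1| <= 2 * k]
   once [|a|] is below [2^-1] and [k]. *)
have [d4 d40 H4] := is_derive_linearize (is_derive_expR (0 : R)) ltr01.
pose d := Num.min (Num.min d1 d2) (Num.min (Num.min d3 d4) (Num.min (2^-1) k)).
exists d; first by rewrite /d !lt_min d10 d20 d30 d40 k0 /= invr_gt0 ltr0n.
move=> t; rewrite /d !lt_min => /andP[/andP[t1 t2] /andP[/andP[t3 t4] /andP[t5 t6]]].
have -> : cexp (w + t) - cexp w - cexp w * t = cexp w * (cexp t - 1 - t).
  by rewrite cexpD; ring.
rewrite cabsM -/C.
suff : cabs (cexp t - 1 - t) <= 7 * k * cabs t.
  move=> H; apply: le_trans (ler_wpM2l (ltW C0) H) _.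
  by rewrite le_eqVlt /k; apply/orP; left; apply/eqP; field; rewrite gt_eqF.
have Rt := Re_le_cabs t; have It := Im_le_cabs t.
case: t t1 t2 t3 t4 t5 t6 Rt It => a b /= t1 t2 t3 t4 t5 t6 Rt It.
set T := cabs (a +i* b) in t1 t2 t3 t4 t5 t6 Rt It *.
have := H1 a (le_lt_trans Rt t1); have := H2 b (le_lt_trans It t2).
have := H3 b (le_lt_trans It t3); have := H4 a (le_lt_trans Rt t4).
rewrite !add0r expR0 cos0 sin0 oppr0 mul0r !mul1r ?subr0 ?addr0.
move=> E4 E3 E2 E1.
have ea2 : `|expR a| <= 2.
  rewrite ger0_norm ?expR_ge0//; move: E4 Rt; rewrite !ler_norml => /andP[? ?] /andP[? ?].
  have : `|a| <= 2^-1 by rewrite ler_norml; lra.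
  by lra.
have ea1 : `|expR a - 1| <= 2 * k.
  have : `|a| <= k by rewrite (le_trans Rt)// ltW.
  have -> : expR a - 1 = (expR a - 1 - a) + a by ring.
  by have := ler_normD (expR a - 1 - a) a; lra.
have -> : cexp (a +i* b) - 1 - (a +i* b) = (expR a * cos b - 1 - a) +i* (expR a * sin b - b).
  by apply/eqP; rewrite eq_complex/= subr0 !eqxx.
apply: le_trans (cabs_leD _ _) _.
have B1 : `|expR a * cos b - 1 - a| <= 2 * (k * T) + k * T.
  have -> : expR a * cos b - 1 - a = expR a * (cos b - 1) + (expR a - 1 - a) by ring.
  apply: le_trans (ler_normD _ _) _; rewrite lerD//; last first.
    by rewrite (le_trans E1)// ler_wpM2l// ltW.
  by rewrite normrM ler_pM// (le_trans E2)// ler_wpM2l// ltW.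
have B2 : `|expR a * sin b - b| <= 2 * (k * T) + 2 * k * T.
  have -> : expR a * sin b - b = expR a * (sin b - b) + (expR a - 1) * b by ring.
  apply: le_trans (ler_normD _ _) _; rewrite lerD// normrM ler_pM//.
  by rewrite (le_trans E3)// ler_wpM2l// ltW.
by have := lerD B1 B2; lra.
Qed.

End ComplexExponential.

(** * The maximum modulus principle *)

Section MaximumModulus.
Variable R : realType.

(** The set is a closed subset of the continuous image of a compact real square. *)
Lemma compact_bounded_closed (K : set R[i]) (M : R) :
  closed K -> (forall z, K z -> cabs z <= M) -> compact K.
Proof.
move=> cK KM.
pose S := (fun p : R * R => p.1 +i* p.2) @` (`[- M, M] `*` `[- M, M]).
apply: (@subclosed_compact _ _ S) => //.
  apply: continuous_compact.
    by apply: continuous_subspaceT; exact: Complex_continuous.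
  by apply: compact_setX; exact: segment_compact.
move=> z /KM zM; exists (complex.Re z, complex.Im z) => /=; last by case: z {zM}.
have := le_trans (Re_le_cabs z) zM; have := le_trans (Im_le_cabs z) zM.
by rewrite !in_itv/= !ler_norml.
Qed.

(** In the coordinate [w] with [z = z0 + rho e^w], the disc without its centre is a half-strip of
    period [2 pi i]. Goursat's lemma equates the mean of [Re h] over the outer circle with that over
    a tiny circle, where [h] is close to [h z0]. *)
Lemma mean_value_le (h : R[i] -> R[i]) (z0 : R[i]) (rho mu : R) : 0 < rho ->
  (forall z, cabs (z - z0) <= rho -> derivable h z 1) ->
  (forall z, cabs (z - z0) = rho -> complex.Re (h z) <= mu) ->
  complex.Re (h z0) <= mu.
Proof.
move=> rho0 dh hmu; apply/ler_addgt0Pr => eta eta0.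
have pi2 : 0 < 2 * pi :> R by rewrite mulr_gt0// pi_gt0.
pose E w := z0 + rho%:C * cexp w.
have cE w : cabs (E w - z0) = rho * expR (complex.Re w).
  by rewrite /E [z0 + _]addrC addrK cabsM cabsR gtr0_norm// cabs_cexp.
pose K w := h (E w).
have dK w : complex.Re w <= 0 -> derivable K w 1.
  move=> w0; apply/derivable1_diffP; apply: differentiable_comp; last first.
    apply/derivable1_diffP; apply: dh.
    by rewrite cE ger_pMr// -expR0 ler_expR.
  apply/derivable1_diffP; apply: derivableD => //.
  by apply: derivableM => //; exact: derivable_cexp.
(* Clamping the real part keeps the parametrisation inside the closed disc, so
   that the primitives below may be taken on a neighbourhood of the rectangle. *)
pose g x y : R[i] := Num.min x 0 +i* y.
have Kg x y : {for g x y, continuous K}.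
  by apply: derivable_continuous; apply: dK; rewrite /= ge_min lexx orbT.
have gx y : continuous (g^~ y).
  move=> x; have H : {for x, continuous (fun x : R => (Num.min x 0, y))}.
    apply: (@cvg_pair R R R (nbhs x) (nbhs (Num.min x 0)) (nbhs y) _ _ _
      (fun x => Num.min x 0) (fun=> y)); last exact: cvg_cst.
    by apply: continuous_min; [exact: cvg_id|exact: cvg_cst].
  exact: (@continuous_comp R (R * R)%type R[i] _ (fun p : R * R => p.1 +i* p.2)
    x H (@Complex_continuous _ _)).
have gy x : continuous (g x).
  move=> y; have H : {for y, continuous (fun y : R => (Num.min x 0, y))}.
    by apply: (@cvg_pair R R R (nbhs y) (nbhs (Num.min x 0)) (nbhs y) _ _ _
      (fun=> Num.min x 0) id); [exact: cvg_cst|exact: cvg_id].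
  exact: (@continuous_comp R (R * R)%type R[i] _ (fun p : R * R => p.1 +i* p.2)
    y H (@Complex_continuous _ _)).
pose P x y := complex.Re (K (g x y)); pose Q x y := complex.Im (K (g x y)).
have cQ y : continuous (Q^~ y).
  move=> x; apply: (@continuous_comp R R[i] R (K \o g^~ y) (@complex.Im R)).
    by apply: continuous_comp; [exact: gx|exact: Kg].
  exact: Im_continuous.
have cP x : continuous (P x).
  move=> y; apply: (@continuous_comp R R[i] R (K \o g x) (@complex.Re R)).
    by apply: continuous_comp; [exact: gy|exact: Kg].
  exact: Re_continuous.
have /continuous_cabsP/(_ eta eta0)[d d0 hd] : {for z0, continuous h}.
  by apply: derivable_continuous; apply: dh; rewrite subrr cabs0 ltW.
(* Chosen so that [rho * expR (- w) < d]: the left side of the rectangle is mapped into the disc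
   where [h] is within [eta] of [h z0]. *)
pose w := 1 + `|ln (d / rho)|.
have w0 : 0 < w by rewrite ltr_pwDl.
have Ew y : cabs (E (g (- w) y) - z0) < d.
  have w1 : - w <= 0 by rewrite oppr_le0 ltW.
  rewrite cE /= min_l// mulrC -ltr_pdivlMr//.
  rewrite -[ltRHS]lnK ?posrE ?divr_gt0// ltr_expR /w.
  have := ler_norm (- ln (d / rho)); rewrite normrN; lra.
have /choice[A dA] y : exists F : R -> R, forall x, - w - 1 < x -> x < 1 -> is_derive x 1 F (Q x y).
  exact: continuous_primitive.
have /choice[B dB] x : exists F : R -> R,
    forall y, - 1 < y -> y < 2 * pi + 1 -> is_derive y 1 F (P x y).
  exact: continuous_primitive.
have {}dA x y : - w <= x -> x <= 0 -> is_derive x 1 (A y) (Q x y).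
  by move=> *; apply: dA; lra.
have {}dB x y : 0 <= y -> y <= 2 * pi -> is_derive y 1 (B x) (P x y).
  by move=> *; apply: dB; lra.
(* With [K = P + i Q], the form [Q dx + P dy] is the imaginary part of [K dw]. *)
have : circulation (fun x y => A y x) B (- w) 0 w (2 * pi) = 0.
  apply: (@goursat_rectangle R P Q) => //.
  - by move=> x y [? ? ? ?]; apply: dA; lra.
  - by move=> x y [? ? ? ?]; apply: dB; lra.
  move=> x y [x1 x2 y1 y2]; have {}x2 : x <= 0 by lra.
  have /cdiffP[b Hb] := dK (x +i* y) x2.
  (* The Cauchy-Riemann equations: multiplication by [b] has the same coefficient [Re b] for [P] in
     x and for [Q] in y. *)
  exists (complex.Re b), (- complex.Im b), (complex.Im b) => e e0.
  have [d' d'0 Hd'] := Hb e e0.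
  exists (d' / 2) => [|x' y' [x'1 x'2 y'1 y'2] xx yy]; first by rewrite divr_gt0.
  have {}x'2 : x' <= 0 by lra.
  have le1 := cabs_leD (x' - x) (y' - y).
  have := Hd' ((x' - x) +i* (y' - y)) ltac:(lra).
  have -> : (x +i* y) + ((x' - x) +i* (y' - y)) = x' +i* y'.
    by apply/eqP; rewrite eq_complex/= !(addrC x) !(addrC y) !subrK !eqxx.
  move=> /le_trans/(_ (ler_wpM2l (ltW e0) le1)) H.
  rewrite /P /Q /g !min_l//.
  move: H; case: (K _) => [k1 k2]; case: (K _) => [l1 l2]; case: b {Hb Hd'} => b1 b2 /= H.
  split; apply: le_trans H.
    apply: le_trans (Re_le_cabs _); rewrite /= le_eqVlt; apply/orP; left.
    by apply/eqP; congr `|_|; ring.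
  apply: le_trans (Im_le_cabs _); rewrite /= le_eqVlt; apply/orP; left.
  by apply/eqP; congr `|_|; ring.
rewrite /circulation add0r addNr.
(* The two horizontal sides cancel since [cexp] has period [2 pi i]. *)
have -> : (A 0 0 - A 0 (- w)) - (A (2 * pi) 0 - A (2 * pi) (- w)) = 0.
  have [||xi _ H] := @primitive_increment R (fun t => A 0 t - A (2 * pi) t)
    (fun t => Q t 0 - Q t (2 * pi)) (- w) 0.
  - by lra.
  - by move=> x ? ?; apply: is_deriveB; exact: dA.
  have E1 : cexp (g xi (2 * pi)) = cexp (g xi 0).
    by rewrite /cexp /g /= [2 * pi]mulr_natl cos2pi sin2pi cos0 sin0.
  have : Q xi 0 - Q xi (2 * pi) = 0 by rewrite /Q /K /E E1 subrr.
  by move=> Q0; move: H; rewrite Q0 mul0r => H; lra.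
have [y1 _ B1] := primitive_increment (ltW pi2) (dB 0).
have [y2 _ B2] := primitive_increment (ltW pi2) (dB (- w)).
rewrite !add0r B1 B2 subr0 -mulrBl => /eqP; rewrite mulf_eq0 (gt_eqF pi2) orbF subr_eq0 => /eqP PP.
have P1 : P 0 y1 <= mu by apply: hmu; rewrite cE /= min_l// expR0 mulr1.
have P2 : complex.Re (h z0) - eta <= P (- w) y2.
  have := hd _ (Ew y2); rewrite -/(K _) /P.
  have := Re_le_cabs (K (g (- w) y2) - h z0).
  case: (K _) (h z0) => [k1 k2] [l1 l2] /=; rewrite ler_norml => /andP[? ?] ?; lra.
lra.
Qed.

(* An interior maximum of [Re (c h) + e |z|^2] contradicts [mean_value_le] for
   [c h + 2 e conj(z0) z], which differs from it on circles around [z0] by the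
   constant [e rho^2 - e |z0|^2]. *)
Lemma maximum_modulus (K : set R[i]) (h : R[i] -> R[i]) (M : R) :
  compact K -> (forall z, K z -> derivable h z 1) ->
  (forall z, K z -> ~ K^° z -> cabs (h z) <= M) ->
  forall z, K z -> cabs (h z) <= M.
Proof.
move=> cK dh hM z1 Kz1.
(* Rotating by [c] turns the modulus at [z1] into a real part, and [cabs c <= 1] preserves the bound
   [M] elsewhere. *)
have [c [c1 cz1]] : exists c : R[i], cabs c <= 1 /\ complex.Re (c * h z1) = cabs (h z1).
  have [->|hz1] := eqVneq (h z1) 0.
    by exists 0; rewrite mul0r cabs0.
  exists (`|h z1| / h z1); rewrite divfK//; split=> //.
  by rewrite cabsM cabsV -cabsE cabsR ger0_norm ?cabs_ge0// divff ?cabs_eq0.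
pose nsq (z : R[i]) : R := complex.Re z ^+ 2 + complex.Im z ^+ 2.
have cnsq : continuous nsq.
  have sq (p : R[i] -> R) : continuous p -> continuous (fun z => p z ^+ 2).
    move=> cp z; exact: (@continuous_comp R[i] R R p (fun x => x ^+ 2) z (cp z)
      (@exprn_continuous _ _ _)).
  move=> z; exact: cvgD (sq _ (@Re_continuous R) z) (sq _ (@Im_continuous R) z).
have [b0 Hb] : exists b0 : R, forall z, K z -> nsq z <= b0.
  have [zb _ Hb] := compact_EVT_max (ex_intro _ z1 Kz1) cK (continuous_subspaceT cnsq).
  by exists (nsq zb) => z Kz; apply: Hb; rewrite inE.
have b00 : 0 <= b0 by rewrite (le_trans _ (Hb _ Kz1))// addr_ge0// sqr_ge0.
apply/ler_addgt0Pr => eta eta0.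
(* Small enough that the perturbation [e * nsq] stays below [eta] on [K]. *)
pose e := eta / (b0 + 1).
have e0 : 0 < e by rewrite divr_gt0// ltr_wpDl.
pose phi z := complex.Re (c * h z) + e * nsq z.
have cphi : {within K, continuous phi}.
  apply: continuous_in_subspaceT => z; rewrite inE => Kz.
  have cch : {for z, continuous (fun z => c * h z)}.
    by apply: derivable_continuous; apply: derivableM => //; exact: dh.
  exact: cvgD (@continuous_comp R[i] R[i] R _ _ z cch (@Re_continuous R _))
    (cvgM (cvg_cst e) (cnsq z)).
have [z0] := compact_EVT_max (ex_intro _ z1 Kz1) cK cphi.
rewrite inE => Kz0 Hz0.
have {}Hz0 z : K z -> phi z <= phi z0 by move=> Kz; apply: Hz0; rewrite inE.
have [/nbhs_cabsP[d d0 dK]|nK] := pselect (K^° z0); last first.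
  have h0 := hM _ Kz0 nK.
  have := Hz0 _ Kz1; rewrite /phi cz1.
  have eb : e * nsq z0 <= eta.
    rewrite (@le_trans _ _ (e * (b0 + 1)))//.
      by rewrite ler_wpM2l ?(ltW e0)//; have := Hb _ Kz0; lra.
    by rewrite /e divfK// gt_eqF// ltr_wpDl.
  have : complex.Re (c * h z0) <= M.
    rewrite (le_trans (ler_norm _))// (le_trans (Re_le_cabs _))// cabsM (le_trans _ h0)//.
    by rewrite ler_piMl// cabs_ge0.
  have : 0 <= e * nsq z1 by rewrite mulr_ge0 ?(ltW e0)// addr_ge0// sqr_ge0.
  by lra.
pose k z := c * h z + (2 * e)%:C * (complex.Re z0 -i* complex.Im z0) * z.
have rek z : complex.Re (k z) = complex.Re (c * h z) +
    2 * e * (complex.Re z0 * complex.Re z + complex.Im z0 * complex.Im z).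
  by rewrite /k ReD; congr (_ + _); case: z {phi cphi Hz0 Kz0 dK k} z0 => [x y] [x0 y0] /=; ring.
pose rho := d / 2; have rho0 : 0 < rho by rewrite divr_gt0.
have Kd z : cabs (z - z0) <= rho -> K z.
  by move=> zr; apply: dK; rewrite (le_lt_trans zr)// /rho; lra.
suff : complex.Re (k z0) <= complex.Re (k z0) - e * rho ^+ 2.
  by have : 0 < e * rho ^+ 2; [rewrite mulr_gt0// exprn_gt0|lra].
apply: (mean_value_le rho0).
  move=> z /Kd/dh/cdiffP dhz; apply/cdiffP.
  apply: cdiffD; first by apply: cdiffM; [exact: cdiff_cst|exact: dhz].
  by apply: cdiffM; [exact: cdiff_cst|exact: cdiff_id].
move=> z zr; have := Hz0 z (Kd z _); rewrite zr => /(_ (lexx _)).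
rewrite /phi !rek -[rho]zr sqr_cabs /nsq.
by case: z {zr} (z0) => [x y] [x0 y0] /= H; lra.
Qed.
End MaximumModulus.

(** * Hermite interpolation and root counting *)

Section HermiteRemainder.
Variable R : realType.

Lemma closed_disc (a : R[i]) (r : R) : closed [set z | cabs (z - a) <= r].
Proof.
rewrite -openC openE => z /negP; rewrite -ltNge => rz.
apply/nbhs_cabsP; exists (cabs (z - a) - r); first by rewrite subr_gt0.
move=> w wz; apply/negP; rewrite -ltNge.
have := cabsD (z - w) (w - a); rewrite addrA subrK cabsBC in wz *; lra.
Qed.

Lemma maximum_modulus_disc (a : R[i]) (rho M : R) (h : R[i] -> R[i]) : 0 < rho ->
  (forall z, cabs (z - a) <= rho -> cdiff h z) ->
  (forall z, cabs (z - a) = rho -> cabs (h z) <= M) ->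
  forall z, cabs (z - a) <= rho -> cabs (h z) <= M.
Proof.
move=> rho0 dh hM; apply: (@maximum_modulus R [set z | cabs (z - a) <= rho]).
- apply: (@compact_bounded_closed R _ (rho + cabs a)); first exact: closed_disc.
  by move=> z /= zr; have := cabsD (z - a) a; rewrite subrK; lra.
- by move=> z zr; apply/cdiffP; exact: dh.
move=> z /= zr ni; apply: hM; apply/eqP; rewrite eq_le zr/= leNgt.
apply/negP => lt; apply: ni; apply/nbhs_cabsP.
exists (rho - cabs (z - a)); first by rewrite subr_gt0.
by move=> w wz /=; have := cabsD (w - z) (z - a); rewrite addrA subrK; lra.
Qed.

Variables (s : nat) (lam : 'I_s -> R[i]) (rho : R).
Hypothesis rho0 : 0 < rho.
Hypothesis lam_sep : forall i j z, i != j -> cabs (z - lam i) <= rho ->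
  rho <= cabs (z - lam j).

(* The remainder is built by Newton's scheme: one node is removed at a time, and
   dividing the estimate at that node by [z - lam i0] costs only a factor
   [2 / rho], by the maximum principle on the disc around it. *)
Lemma hermite_remainder N (m : 'I_s -> nat) : \sum_i m i = N ->
  exists2 C : R, 0 <= C & forall (Q : {poly R[i]}) (S : 'I_s -> R[i] -> R[i]) gamma,
    0 <= gamma ->
    (forall i z, cabs (z - lam i) <= rho -> cdiff (S i) z) ->
    (forall i z, cabs (z - lam i) <= rho ->
       cabs (Q.[z] - (z - lam i) ^+ m i * S i z) <= gamma) ->
    exists U T : {poly R[i]}, [/\ Q = \prod_i ('X - (lam i)%:P) ^+ m i * U + T,
      (size T <= N)%N & forall k, cabs T`_k <= C * gamma].
Proof.
elim: N m => [|N IH] m mN.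
  exists 0 => // Q S gamma g0 _ _; exists Q, 0; split.
  - rewrite big1 ?mul1r ?addr0// => i _.
    by move/eqP: mN; rewrite sum_nat_eq0 => /forallP/(_ i)/eqP ->.
  - by rewrite size_poly0.
  - by move=> k; rewrite coef0 cabs0 mul0r.
have [i0 mi0] : exists i0, (0 < m i0)%N.
  apply: contrapT => m0; suff : \sum_i m i = 0%N by rewrite mN.
  by apply: big1 => i _; apply/eqP; rewrite -leqn0 leqNgt; apply/negP => mi; apply: m0; exists i.
pose m' i := (m i - (i == i0))%N.
have m'N : \sum_i m' i = N.
  have E : \sum_(i | i != i0) m' i = \sum_(i | i != i0) m i.
    by apply: eq_bigr => i /negbTE ni; rewrite /m' ni subn0.
  have mS := mN; rewrite (bigD1 i0)//= in mS.
  rewrite (bigD1 i0)//= E /m' eqxx subn1; apply: succn_inj.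
  by rewrite -mS -addSn prednK.
have [C1 C10 H1] := IH m' m'N.
(* The new remainder is [T * ('X - lam i0) + c]. Each coefficient combines two of [T], with weights
   1 and [cabs (lam i0)], and possibly [c], which is at most [gamma]. *)
exists (C1 * (2 / rho) * (1 + cabs (lam i0)) + 1).
  by rewrite addr_ge0// !mulr_ge0// ?invr_ge0 ?(ltW rho0)// addr_ge0// cabs_ge0.
move=> Q S gamma g0 dS QS.
pose c := Q.[lam i0].
have cg : cabs c <= gamma.
  have := QS i0 (lam i0); rewrite subrr cabs0 expr0n eqn0Ngt mi0 mul0r subr0.
  by apply; exact: ltW.
have /factor_theorem[Q1 QE] : root (Q - c%:P) (lam i0).
  by rewrite rootE !hornerE subrr.
have {}QE : Q = Q1 * ('X - (lam i0)%:P) + c%:P by rewrite -QE subrK.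
have Qz z : Q.[z] - c = (z - lam i0) * Q1.[z].
  by rewrite [in LHS]QE !hornerE addrK mulrC.
(* At [i0] the divided factor comes off the power [m i0]; at the other nodes it does not vanish and
   is absorbed into [S]. *)
pose S' i z := if i == i0 then S i z else S i z / (z - lam i0).
have far i z : i != i0 -> cabs (z - lam i) <= rho -> z - lam i0 != 0.
  by move=> ii /(lam_sep ii) H; rewrite -cabs_gt0 (lt_le_trans rho0).
have g20 : 0 <= 2 / rho * gamma by rewrite mulr_ge0// divr_ge0// ltW.
have [] := H1 Q1 S' (2 / rho * gamma) g20.
- move=> i z zi; rewrite /S'; case: eqVneq => [_|ii]; first exact: dS.
  apply: cdiffM; first exact: dS.
  apply: cdiffV; first exact: far zi.
  by apply: cdiffB; [exact: cdiff_id|exact: cdiff_cst].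
- have bnd i z : cabs (z - lam i) <= rho ->
      cabs (Q.[z] - c - (z - lam i) ^+ m i * S i z) <= 2 * gamma.
    move=> /QS H; rewrite addrAC; have := cabsB (Q.[z] - (z - lam i) ^+ m i * S i z) c; lra.
  move=> i z; have [->|ii] := eqVneq i i0; last first.
    move=> zi; rewrite /S' /m' (negbTE ii) subn0.
    have -> : Q1.[z] - (z - lam i) ^+ m i * (S i z / (z - lam i0)) =
      (Q.[z] - c - (z - lam i) ^+ m i * S i z) / (z - lam i0).
      by rewrite Qz; field; exact: far zi.
    rewrite cabsM cabsV ler_pdivrMr ?cabs_gt0 ?(far i)//.
    apply: le_trans (bnd _ _ zi) _.
    have -> : 2 * gamma = 2 / rho * gamma * rho by field; rewrite gt_eqF.
    apply: ler_wpM2l => //.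
    exact: lam_sep zi.
  apply: (@maximum_modulus_disc (lam i0) rho _
    (fun z => Q1.[z] - (z - lam i0) ^+ m' i0 * S' i0 z)) => // {}z zi.
    apply: cdiffB; first exact: cdiff_horner.
    apply: cdiffM; last by rewrite /S' eqxx; exact: dS.
    rewrite (_ : (fun _ => _) = horner (('X - (lam i0)%:P) ^+ m' i0)).
      exact: cdiff_horner.
    by apply/funext => x; rewrite !hornerE.
  have z0 : z - lam i0 != 0 by rewrite -cabs_gt0 zi.
  rewrite -(ler_pM2l rho0) -{1}zi -cabsM mulrBr -Qz mulrA -exprS.
  rewrite /S' eqxx /m' eqxx subn1 prednK//.
  have -> : rho * (2 / rho * gamma) = 2 * gamma by field; rewrite gt_eqF.
  by apply: bnd; rewrite zi.
move=> U [T [Q1E sT bT]].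
exists U, (T * ('X - (lam i0)%:P) + c%:P); split.
- rewrite QE Q1E mulrDl addrA; congr (_ + _ + _).
  rewrite mulrAC; congr (_ * _).
  rewrite (bigD1 i0)//= [RHS](bigD1 i0)//= mulrAC -exprSr {1}/m' eqxx subn1 prednK//.
  by congr (_ * _); apply: eq_bigr => i /negbTE ni; rewrite /m' ni subn0.
- rewrite (leq_trans (size_polyD _ _))// geq_max (leq_trans (size_polyMleq _ _))/=.
    by rewrite (leq_trans (size_polyC_leq1 _)).
  by rewrite size_XsubC addn2/=.
- move=> k; rewrite mulrBr coefD coefB coefMX coefMC coefC.
  have l0 := cabs_ge0 (lam i0).
  have b1 : cabs (if k == 0%N then 0 else T`_k.-1) <= C1 * (2 / rho * gamma).
    by case: ifP => // _; rewrite cabs0 mulr_ge0.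
  have b2 : cabs (T`_k * lam i0) <= C1 * (2 / rho * gamma) * cabs (lam i0).
    by rewrite cabsM ler_wpM2r.
  have b3 : cabs (if k == 0%N then c else 0) <= gamma by case: ifP => // _; rewrite cabs0.
  apply: le_trans (cabsD _ _) _; apply: le_trans (lerD (cabsB _ _) b3) _.
  by have := lerD b1 b2; lra.
Qed.

End HermiteRemainder.

(** * Roots of a monic polynomial close to a given product *)

Section RootCounting.
Variable R : realType.

Lemma nroots_prod_XsubC (c : R[i]) (rs : seq R[i]) (A : set R[i]) : c != 0 ->
  nroots (c *: \prod_(z <- rs) ('X - z%:P)) A = count (fun z => z \in A) rs.
Proof.
move=> c0; set p := _ *: _.
have mupE z : mup z p = count_mem z rs.
  by rewrite /p -mul_polyC mupMr ?mu_prod_XsubC// rootC.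
rewrite /nroots (eq_fsbigr (fun z => count_mem z rs)); last by move=> z _; exact: mupE.
rewrite (@fsbigE _ 0%N addn _ _ [seq z <- undup rs | z \in A]); first last.
- move=> z Az; rewrite mem_filter mem_undup (mem_set Az)/=.
  by move=> /count_memPn.
- by move=> z /=; rewrite mem_filter => /andP[/set_mem].
- by rewrite filter_uniq// undup_uniq.
rewrite big_filter_cond (eq_bigl (fun z => z \in A)); last by move=> z; rewrite andbb.
rewrite -sum1_count -[RHS](big_undup_iterop_count addn).
apply: eq_bigr => z _.
by rewrite Monoid.iteropE; elim: (count_mem z rs) => //= n <-.
Qed.

Lemma prod_expr_ge (I : Type) (r : seq I) (P : pred I) (F : I -> R) (k : I -> nat) (c : R) :
  0 <= c -> (forall i, P i -> c <= F i) ->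
  c ^+ (\sum_(i <- r | P i) k i) <= \prod_(i <- r | P i) F i ^+ k i.
Proof.
move=> c0 cF; rewrite expr_sum; apply: ler_prod => i Pi.
by rewrite exprn_ge0//= lerXn2r ?nnegrE ?(le_trans c0)// cF.
Qed.

Lemma prod_expr_le (I : Type) (r : seq I) (P : pred I) (F : I -> R) (k : I -> nat) (c : R) :
  (forall i, P i -> 0 <= F i <= c) ->
  \prod_(i <- r | P i) F i ^+ k i <= c ^+ (\sum_(i <- r | P i) k i).
Proof.
move=> cF; rewrite expr_sum; apply: ler_prod => i /cF /andP[F0 Fc].
by rewrite exprn_ge0//= lerXn2r ?nnegrE ?(le_trans F0).
Qed.

Lemma horner_cabs_le (T : {poly R[i]}) (N : nat) (eta B : R) (z : R[i]) :
  (size T <= N)%N -> (forall k, cabs T`_k <= eta) -> 1 <= B -> cabs z <= B ->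
  cabs T.[z] <= eta * (N%:R * B ^+ N).
Proof.
move=> sT Te B1 zB.
have e0 : 0 <= eta by apply: le_trans (Te 0%N); exact: cabs_ge0.
have B0 : 0 <= B by exact: le_trans B1.
rewrite (horner_coef_wide _ sT).
have : cabs (\sum_(i < N) T`_i * z ^+ i) <= \sum_(i < N) eta * B ^+ N.
  elim/big_ind2 : _ => [|x1 x2 y1 y2 H1 H2|i _]; first by rewrite cabs0.
    by apply: le_trans (cabsD _ _) _; exact: lerD.
  rewrite cabsM cabsX ler_pM ?exprn_ge0 ?cabs_ge0// (@le_trans _ _ (B ^+ i))//.
    by rewrite lerXn2r ?nnegrE ?cabs_ge0.
  by rewrite ler_weXn2l// ltnW.
by rewrite sumr_const card_ord -[_ *+ N]mulr_natl mulrCA.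
Qed.

(** If the degree of [Q] were below [N], then [U = 0] and [Q = T], whose coefficients are too small
    for a monic polynomial. With equal degrees, [q * (U - 1) = Q - q - T] has degree below that of
    [q], so [U = 1]. *)
Lemma monic_quotient_eq1 (Q q U T : {poly R[i]}) (N : nat) : Q \is monic ->
  q \is monic -> size q = N.+1 -> (size Q <= N.+1)%N -> Q = q * U + T ->
  (size T <= N)%N -> (forall k, cabs T`_k < 1) -> size Q = N.+1 /\ U = 1.
Proof.
move=> mQ mq sq sQ QE sT T1.
have small (V : {poly R[i]}) : (size (q * V)%R <= N)%N -> V = 0.
  move=> H; apply/eqP; apply: contraTT H => V0.
  rewrite mulrC size_Mmonic// sq addnS /= -ltnNge -[leqLHS]add1n leq_add2r.
  by rewrite size_poly_gt0.
have [sQN|sQN] := leqP (size Q) N.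
  have U0 : U = 0.
    apply: small; have -> : q * U = Q - T by rewrite QE addrK.
    by rewrite (leq_trans (size_polyD _ _))// size_polyN geq_max sQN.
  have := T1 (size Q).-1; move: QE; rewrite U0 mulr0 add0r => <-.
  by rewrite -lead_coefE (eqP mQ) cabs1 ltxx.
have {}sQ : size Q = N.+1 by apply/eqP; rewrite eqn_leq sQ.
split => //; apply/eqP; rewrite -subr_eq0; apply/eqP/small.
have -> : q * (U - 1) = (Q - q) - T by rewrite QE; ring.
rewrite (leq_trans (size_polyD _ _))// size_polyN geq_max sT andbT.
apply/leq_sizeP => j; rewrite leq_eqVlt => /orP[/eqP <-|Nj].
  have := eqP mQ; have := eqP mq; rewrite !lead_coefE sq sQ /= => E1 E2.
  by rewrite coefB E1 E2 subrr.
by rewrite coefB !nth_default ?subrr// ?sQ ?sq.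
Qed.

(** Every root lies near exactly one [lam i], so the counts add up to [N], the sum of the [m i]. It
    then suffices to bound each count from below by [m i]. *)
Lemma root_count (s : nat) (lam : 'I_s -> R[i]) (m : 'I_s -> nat) (N : nat) (d B : R) :
  \sum_i m i = N -> (forall i, 0 < m i)%N -> 0 < d -> d <= 1 ->
  (forall i j, i != j -> 2 * d <= cabs (lam i - lam j)) ->
  (forall i j, cabs (lam i - lam j) <= 1) ->
  (forall i, cabs (lam i) + 1 <= B) ->
  exists2 eps0 : R, 0 < eps0 & forall (rs : seq R[i]) (U T : {poly R[i]}) (eta eps : R),
    (size rs <= N)%N -> (forall z, z \in rs -> cabs z <= B) ->
    \prod_(z <- rs) ('X - z%:P) = \prod_i ('X - (lam i)%:P) ^+ m i * U + T ->
    (size T <= N)%N -> (forall k, cabs T`_k <= eta) ->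
    0 < eps <= eps0 -> 2 * eta <= eps -> eta * (N%:R * B ^+ N) <= d ^+ N * eps ->
    forall i, count (fun z => cabs (z - lam i) ^+ m i <= eps) rs = m i.
Proof.
move=> mN m0 d0 d1 sep close lamB.
have miN i : (m i <= N)%N by rewrite -mN (bigD1 i)//= leq_addr.
(* With fewer than [m i] roots near [lam i], the value of the left-hand side at
   [lam i + t] is at least of order [t ^+ (m i).-1], against [t ^+ m i] on the
   right; this [t] is small enough for a contradiction. *)
pose t := (d / 4) ^+ N / (2 ^+ N + 1) * (d / 2).
have P2 : 0 < 2 ^+ N + 1 :> R by rewrite addr_gt0// exprn_gt0.
have d40 : 0 < (d / 4) ^+ N by rewrite exprn_gt0// divr_gt0.
have t0 : 0 < t by rewrite !mulr_gt0// ?invr_gt0.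
have td : t <= d / 2.
  rewrite ler_piMl ?divr_ge0 ?(ltW d0)// ler_pdivrMr// mul1r.
  rewrite (@le_trans _ _ 1)//; last by rewrite lerDr exprn_ge0.
  by rewrite exprn_ile1 ?divr_ge0 ?(ltW d0)//; lra.
have tlt : t * (2 ^+ N + 1) < (d / 4) ^+ N.
  have -> : t * (2 ^+ N + 1) = (d / 4) ^+ N * (d / 2) by rewrite /t; field; rewrite gt_eqF.
  by rewrite gtr_pMr//; lra.
pose tau := t / 2; have tau0 : 0 < tau by rewrite divr_gt0.
(* Then [eps <= tau ^+ m i] for every [i], so a root counted at [lam i] is within [tau = t / 2] of
   it and at least [t / 2] away from the test point at distance [t]. *)
exists (tau ^+ N); first exact: exprn_gt0.
move=> rs U T eta eps srs rsB QE sT Te /andP[e0 ee0] e1 e2.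
have tau1 : tau <= 1 by rewrite /tau; lra.
have eps1 : eps <= 1 by rewrite (le_trans ee0)// exprn_ile1// ltW.
have mq : \prod_i ('X - (lam i)%:P) ^+ m i \is monic.
  by apply: monic_prod => i _; rewrite monic_exp// monicXsubC.
have sq : size (\prod_i ('X - (lam i)%:P) ^+ m i) = N.+1.
  rewrite size_prod; last by move=> i _; rewrite expf_neq0// polyXsubC_eq0.
  rewrite (eq_bigr (fun i => 1 + m i)%N) => [|i _]; last by rewrite size_exp_XsubC.
  by rewrite big_split/= mN sum1_card -addnS addKn.
have [] := monic_quotient_eq1 (monic_prod_XsubC _ _ _) mq sq _ QE sT.
- by rewrite size_prod_XsubC ltnS.
- by move=> k; rewrite (le_lt_trans (Te k))//; lra.
rewrite size_prod_XsubC => -[rsN] U1; rewrite U1 mulr1 in QE.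
have [N0|N0] := posnP N.
  by move=> i; have := m0 i; rewrite lt0n; have := miN i; rewrite N0 leqn0 => ->.
have [i1 _] : exists i : 'I_s, (0 < m i)%N.
  apply: contrapT => H; suff N0' : N = 0%N by rewrite N0' in N0.
  by rewrite -mN; apply: big1 => i _; case: (H); exists i.
have TB z : cabs z <= B -> cabs T.[z] <= d ^+ N * eps.
  move=> zB; apply: le_trans e2; apply: horner_cabs_le => //.
  by have := lamB i1; have := cabs_ge0 (lam i1); lra.
have qE z : cabs (\prod_i ('X - (lam i)%:P) ^+ m i).[z] = \prod_i cabs (z - lam i) ^+ m i.
  rewrite horner_prod cabs_prod; apply: eq_bigr => i _.
  by rewrite horner_exp hornerXsubC cabsX.
pose isnear i z := cabs (z - lam i) ^+ m i <= eps.
have nearW i z : isnear i z -> cabs (z - lam i) <= tau.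
  move=> /le_trans/(_ ee0) H; rewrite -(@ler_pXn2r _ (m i)) ?nnegrE ?cabs_ge0 ?(ltW tau0) ?m0//.
  by rewrite (le_trans H)// ler_wiXn2l// ltW.
have tri (a b z : R[i]) : cabs (a - b) <= cabs (z - a) + cabs (z - b).
  by rewrite (cabsBC z a); have := cabsD (a - z) (z - b); rewrite addrA subrK.
have near_uniq i j z : isnear i z -> isnear j z -> i = j.
  move=> /nearW zi /nearW zj; apply/eqP; apply: contraT => /sep ij.
  by have := tri (lam i) (lam j) z; rewrite /tau in zi zj; lra.
have near_ex z : z \in rs -> exists i, isnear i z.
  move=> zrs.
  have qz : \prod_i cabs (z - lam i) ^+ m i <= d ^+ N * eps.
    have := TB z (rsB z zrs).
    suff -> : T.[z] = - (\prod_i ('X - (lam i)%:P) ^+ m i).[z] by rewrite cabsN qE.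
    apply/eqP; rewrite -addr_eq0 addrC -hornerD -QE.
    by have := root_prod_XsubC rs z; rewrite zrs.
  (* By the separation [2 * d], at most one node is within [d] of [z]. The other factors of the
     product contribute at least [d ^+ N], which leaves at most [eps] for the factor at [i0]. *)
  have [i0 Hi0] : exists i0, forall j, j != i0 -> d <= cabs (z - lam j).
    have [[i zi]|N1] := pselect (exists i, cabs (z - lam i) < d).
      by exists i => j /sep; have := tri (lam j) (lam i) z; lra.
    by exists i1 => j _; rewrite leNgt; apply/negP => zj; apply: N1; exists j.
  exists i0; rewrite /isnear.
  have E := mN; rewrite (bigD1 i0)//= in E; rewrite (bigD1 i0)//= in qz.
  have H := @prod_expr_ge _ (index_enum 'I_s) (fun j => j != i0)
    (fun j => cabs (z - lam j)) m d (ltW d0) Hi0.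
  have dN : 0 < d ^+ N by exact: exprn_gt0.
  have H2 : d ^+ N <= \prod_(j | j != i0) cabs (z - lam j) ^+ m j.
    by apply: le_trans H; rewrite -E ler_wiXn2l ?leq_addl// ltW.
  rewrite -(ler_pM2l dN); apply: le_trans qz; rewrite mulrC ler_wpM2l//.
  by rewrite exprn_ge0// cabs_ge0.
have sumN : \sum_i count (isnear i) rs = N.
  rewrite -rsN -[RHS]sum1_size.
  rewrite (eq_bigr (fun i => \sum_(z <- rs) if isnear i z then 1%N else 0%N)); last first.
    by move=> i _; rewrite -sum1_count big_mkcond.
  rewrite exchange_big/= big_seq [RHS]big_seq; apply: eq_bigr => z /near_ex[i zi].
  rewrite (bigD1 i)//= zi big1// => j ji; case: ifP => // zj.
  by move: ji; rewrite (near_uniq _ _ _ zj zi) eqxx.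
have lower i : (m i <= count (isnear i) rs)%N.
  rewrite leqNgt; apply/negP => ki.
  pose w := lam i + t%:C.
  have wi : cabs (w - lam i) = t by rewrite /w addrAC subrr add0r cabsR gtr0_norm.
  have wB : cabs w <= B.
    by have := cabsD (lam i) t%:C; have := lamB i; rewrite cabsR gtr0_norm// -/w; lra.
  (* A root near [lam i] gives a factor at least [t / 2], any other at least [d / 2]. Since
     [d / 2 <= 1], its exponent may be raised to [N]. *)
  have Qw : (t / 2) ^+ (count (isnear i) rs) * (d / 2) ^+ N <=
      cabs (\prod_(z <- rs) ('X - z%:P)).[w].
    have far z : z \in rs -> ~~ isnear i z -> d / 2 <= cabs (w - z).
      move=> /near_ex[j zj] ni.
      have ij : j != i by apply: contraNneq ni => <-.
      have := sep _ _ ij; have := nearW _ _ zj.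
      have := tri (lam j) (lam i) z; have := tri z (lam i) w.
      by rewrite wi /tau; lra.
    have close' z : isnear i z -> t / 2 <= cabs (w - z).
      by move=> /nearW; have := tri w (lam i) z; rewrite wi (cabsBC z w) /tau; lra.
    rewrite horner_prod cabs_prod -rsN.
    under eq_bigr do rewrite hornerXsubC.
    elim: (rs) far {srs rsB QE rsN near_ex sumN ki} => [|z l IH] far.
      by rewrite big_nil /= !expr0 mulr1.
    have {}IH := IH (fun z zl => far z (mem_behead (s := _ :: _) zl)).
    rewrite big_cons /=.
    have p0 : 0 <= (t / 2) ^+ count (isnear i) l * (d / 2) ^+ size l.
      by rewrite mulr_ge0// exprn_ge0// divr_ge0// ltW.
    case: (boolP (isnear i z)) => nz /=; rewrite ?add1n ?add0n.
      have -> : (t / 2) ^+ (count (isnear i) l).+1 * (d / 2) ^+ (size l).+1 =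
        (t / 2) * (((t / 2) ^+ count (isnear i) l * (d / 2) ^+ size l) * (d / 2)).
        by rewrite !exprS; ring.
      apply: ler_pM; [lra| |exact: close'|].
        by rewrite mulr_ge0// divr_ge0// ltW.
      by apply: le_trans IH; rewrite ler_piMr//; lra.
    have -> : (t / 2) ^+ (count (isnear i) l) * (d / 2) ^+ (size l).+1 =
      (d / 2) * ((t / 2) ^+ count (isnear i) l * (d / 2) ^+ size l).
      by rewrite !exprS; ring.
    apply: ler_pM => //; first by lra.
    by apply: far => //; rewrite mem_head.
  (* The remaining factors are at most [t + 1 <= 2], as nodes are at mutual distance at most 1. *)
  have qw : \prod_j cabs (w - lam j) ^+ m j <= t ^+ m i * 2 ^+ N.
    rewrite (bigD1 i)//= wi ler_wpM2l ?exprn_ge0 ?(ltW t0)//.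
    apply: le_trans (@prod_expr_le _ (index_enum 'I_s) (fun j => j != i)
      (fun j => cabs (w - lam j)) m 2 _) _.
      move=> j _; rewrite cabs_ge0/=.
      have := cabsD (w - lam i) (lam i - lam j); rewrite addrA subrK wi.
      by have := close i j; lra.
    rewrite ler_weXn2l ?ler1n//.
    by rewrite -mN [leqRHS](bigD1 i)//= leq_addl.
  have Tw : cabs T.[w] <= t ^+ m i.
    apply: le_trans (TB _ wB) _; apply: (@le_trans _ _ eps).
      by rewrite ler_piMl ?(ltW e0)// exprn_ile1// ltW.
    apply: le_trans ee0 _; apply: (@le_trans _ _ (tau ^+ m i)).
      by rewrite ler_wiXn2l// ltW.
    by rewrite lerXn2r ?nnegrE ?(ltW tau0) ?(ltW t0)// /tau; lra.
  have ub : (t / 2) ^+ (m i).-1 * (d / 2) ^+ N <= t ^+ m i * (2 ^+ N + 1).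
    apply: (@le_trans _ _ (cabs (\prod_(z <- rs) ('X - z%:P)).[w])).
      apply: le_trans Qw; rewrite ler_wpM2r ?exprn_ge0 ?divr_ge0 ?(ltW d0)//.
      rewrite ler_wiXn2l ?divr_ge0 ?(ltW t0)//.
      by rewrite -ltnS prednK.
    rewrite QE hornerD; apply: le_trans (cabsD _ _) _.
    by rewrite qE mulrDr mulr1 lerD.
  have tm : t ^+ m i = t ^+ (m i).-1 * t by rewrite -exprSr prednK.
  have tp : 0 < t ^+ (m i).-1 by exact: exprn_gt0.
  have {}ub : 2^-1 ^+ (m i).-1 * (d / 2) ^+ N <= t * (2 ^+ N + 1).
    rewrite -(ler_pM2l tp) [leLHS]mulrA -exprMn.
    by rewrite [leRHS]mulrA -tm.
  move: ub; apply/negP; rewrite -ltNge; apply: lt_le_trans tlt _.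
  have -> : (d / 4) ^+ N = 2^-1 ^+ N * (d / 2) ^+ N.
    by rewrite -exprMn; congr (_ ^+ _); field.
  rewrite ler_wpM2r ?exprn_ge0 ?divr_ge0 ?(ltW d0)//.
  by rewrite ler_wiXn2l ?invr_ge0// ?invf_le1 ?ler1n// (leq_trans (leq_pred _)).
move=> i; have H : (\sum_j count (isnear j) rs <= \sum_j m j)%N by rewrite sumN mN.
rewrite (bigD1 i)//= [leqRHS](bigD1 i)//= in H.
have L : (\sum_(j | j != i) m j <= \sum_(j | j != i) count (isnear j) rs)%N.
  by apply: leq_sum => j _; exact: lower.
apply/eqP; rewrite eqn_leq lower andbT.
by rewrite -(leq_add2r (\sum_(j | j != i) m j)) (leq_trans _ H)// leq_add2l.
Qed.
End RootCounting.

(** * The rational approximants *)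

Section Assembly.
Variable R : realType.
Implicit Types (D : set R[i]) (f : R[i] -> R[i]).

(** Including 1 in the minimum covers an empty [T] and makes powers of the bound decrease with the
    exponent. *)
Lemma fin_lower_bound (T : finType) (F : T -> R) : (forall x, 0 < F x) ->
  exists2 c : R, 0 < c <= 1 & forall x, c <= F x.
Proof.
move=> F0; exists (\big[Num.min/1]_x F x).
  apply/andP; split; last exact: bigmin_le_id.
  by apply/bigmin_gtP; split=> // x _; exact: F0.
by move=> x; exact: bigmin_le.
Qed.

Lemma closure_diameter_le D (z w : R[i]) : diameter D = 1%:E -> closure D z -> D w ->
  cabs (z - w) <= 1.
Proof.
move=> dD cz Dw; apply/ler_addgt0Pr => e e0.
have [|x [Dx xz]] := cz [set x | cabs (x - z) < e].
  by apply/nbhs_cabsP; exists e.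
have : cabs (x - w) <= 1.
  by rewrite -lee_fin -dD; apply: ereal_sup_ubound; exists (x, w).
have := cabsD (z - x) (x - w); rewrite addrA subrK (cabsBC z); rewrite /= in xz; lra.
Qed.

Lemma compact_closure_diameter D : D !=set0 -> diameter D = 1%:E -> compact (closure D).
Proof.
move=> [w Dw] dD; apply: (@compact_bounded_closed R _ (1 + cabs w)).
  exact: closed_closure.
move=> z cz; have := closure_diameter_le dD cz Dw.
by have := cabsD (z - w) w; rewrite subrK; lra.
Qed.

Lemma holomorphic_at_near f z : holomorphic_at z f ->
  exists2 d : R, 0 < d & forall w, cabs (w - z) < d -> cdiff f w.
Proof.
move=> [U]; rewrite open_nbhsE => -[_ /nbhs_cabsP[d d0 dU]] hU.
by exists d => // w /dU Uw; apply/cdiffP; exact: hU.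
Qed.

Lemma pole_local D f (a : R[i]) (k : nat) : open D -> D a -> pole_of_order f a k ->
  exists g : R[i] -> R[i], exists c d : R, [/\ 0 < c, 0 < d &
    forall z, cabs (z - a) < d -> [/\ cdiff g z, c <= cabs (g z), D z &
      z != a -> f z = g z / (z - a) ^+ k]].
Proof.
move=> oD Da [_ [g [/holomorphic_at_near[d1 d10 dg] ga fg]]].
have [d2 d20 dD] : exists2 d : R, 0 < d & forall w, cabs (w - a) < d -> D w.
  by apply/nbhs_cabsP; exact: open_nbhs_nbhs.
have [d3 d30 df] : exists2 d : R, 0 < d & forall w, cabs (w - a) < d ->
    w != a -> f w = g w / (w - a) ^+ k.
  by move/nbhs_cabsP: fg.
have ca : 0 < cabs (g a) / 2 by rewrite divr_gt0// cabs_gt0.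
have /derivable_continuous/continuous_cabsP/(_ _ ca)[d4 d40 dc] : derivable g a 1.
  by apply/cdiffP; apply: dg; rewrite subrr cabs0.
exists g, (cabs (g a) / 2), (Num.min (Num.min d1 d2) (Num.min d3 d4)); split => //.
  by rewrite !lt_min d10 d20 d30.
move=> z; rewrite !lt_min => /andP[/andP[z1 z2] /andP[z3 z4]]; split.
- exact: dg.
- have := dc z z4; have := cabsD (g a - g z) (g z); rewrite subrK cabsBC; lra.
- exact: dD.
- exact: df.
Qed.

(** The roots of the denominator inside [D] are listed in [rs]; [Qo] collects the others and the
    leading coefficient, so that the numerator over [Qo] is holomorphic on [D]. *)
Lemma ratfun_split D (r : ratfun R) : exists (rs : seq R[i]) (Qo : {poly R[i]}),
  [/\ forall z, z \in rs -> D z, rden r = \prod_(z <- rs) ('X - z%:P) * Qo,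
    forall z, D z -> Qo.[z] != 0 &
    forall A, A `<=` D -> npoles r A = count (fun z => z \in A) rs].
Proof.
have [rs0 E] := closed_field_poly_normal (rden r).
have l0 : lead_coef (rden r) != 0 by rewrite lead_coef_eq0 rden_neq0.
exists [seq z <- rs0 | z \in D], (lead_coef (rden r) *: \prod_(z <- rs0 | z \notin D) ('X - z%:P)).
split.
- by move=> z; rewrite mem_filter => /andP[/set_mem].
- by rewrite {1}E -scalerAr big_filter [in LHS](bigID (fun z => z \in D)).
- move=> z Dz; rewrite hornerZ mulf_neq0// horner_prod prodf_seq_neq0.
  apply/allP => x _; apply/implyP => xD; rewrite hornerXsubC subr_eq0.
  by apply: contraNneq xD => <-; exact: mem_set.
- move=> A AD; rewrite /npoles E nroots_prod_XsubC// count_filter.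
  apply: eq_count => z /=; apply/idP/andP => [zA|[]//].
  by split => //; apply/mem_set/AD/set_mem.
Qed.

Lemma Lambda_memE D (a : R[i]) (k : nat) (e : R) (z : R[i]) : (0 < k)%N -> 0 < e -> D z ->
  (z \in Lambda D a k e) = (cabs (z - a) ^+ k <= e).
Proof.
move=> k0 e0 Dz.
have eE : (e `^ k%:R^-1) ^+ k = e.
  by rewrite -powR_mulrn ?powR_ge0// -powRrM mulVf ?pnatr_eq0 -?lt0n// powRr1// ltW.
apply/idP/idP => [/set_mem[_ H]|H].
  by rewrite -[leRHS]eE lerXn2r ?nnegrE ?cabs_ge0 ?powR_ge0.
apply: mem_set; split => //.
by rewrite -(@ler_pXn2r _ k) ?nnegrE ?cabs_ge0 ?powR_ge0// eE.
Qed.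

(** A zero of the denominator in [A] would contribute [+oo], so a real bound excludes it. *)
Lemma supnorm_diff_le (A : set R[i]) f (r : ratfun R) (c : R) (z : R[i]) :
  (supnorm_diff A f r <= c%:E)%E -> A z ->
  (rden r).[z] != 0 /\ cabs (f z - rateval r z) <= c.
Proof.
move=> H Az.
have := le_trans (ereal_sup_ubound (imageP _ Az)) H.
by case: eqVneq.
Qed.

Lemma cabs_prod_XsubC_le1 (rs : seq R[i]) (z : R[i]) :
  (forall x, x \in rs -> cabs (z - x) <= 1) -> cabs (\prod_(x <- rs) ('X - x%:P)).[z] <= 1.
Proof.
elim: rs => [|x rs IH] H; first by rewrite big_nil hornerC cabs1.
rewrite big_cons hornerM cabsM hornerXsubC mulr_ile1 ?cabs_ge0//.
  by apply: H; rewrite mem_head.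
by apply: IH => y yrs; apply: H; rewrite in_cons yrs orbT.
Qed.
End Assembly.

Theorem theorem3p2 (R : realType) (D : set R[i]) (f : R[i] -> R[i])
    (s : nat) (lam : 'I_s -> R[i]) (m : 'I_s -> nat)
    (mt : nat -> nat) (r : nat -> ratfun R) (gamma : nat -> R)
    (domD : domain D) (bndD : bounded_set D) (diamD : diameter D = 1%:E)
    (merof : meromorphic_on D f)
    (holf : exists U : set R[i],
      [/\ open U, boundary D `<=` U & holomorphic_on U f])
    (lam_inj : injective lam)
    (polesf : [set z | D z /\ is_pole f z] = range lam)
    (orderf : forall i, pole_of_order f (lam i) (m i))
    (rn_class : forall n, ratclass D n (mt n) (r n))
    (rn_approx : forall n,
      (supnorm_diff (boundary D) f (r n) <= (gamma n)%:E)%E)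
    (gamma_lim : gamma @ \oo --> (0 : R))
    (mt_le : forall n, (mt n <= \sum_(i < s) m i)%N) :
  exists eps0 C : R, [/\ 0 < eps0, 0 < C &
    forall (eps : R) (n : nat), 0 < eps <= eps0 -> gamma n <= C^-1 * eps ->
      forall i : 'I_s, npoles (r n) (Lambda D (lam i) (m i) eps) = m i].
Proof.
have [[z0 Dz0] oD _] := domD.
have lamD i : D (lam i).
  have : range lam (lam i) by exists i.
  by rewrite -polesf => -[].
have m_gt0 i : (0 < m i)%N by have [] := orderf i.
set N := (\sum_(i < s) m i)%N in mt_le.
(* The maximum principle is applied on the compact set [closure D]. Its interior may exceed [D], but
   by this inclusion its non-interior points lie in [boundary D]. *)
have DintD : D `<=` (closure D)^°.
  move=> z Dz; apply: (interiorS (@subset_closure _ D)).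
  exact: open_nbhs_nbhs.
have clD z : closure D z -> D z \/ boundary D z.
  move=> cz; have [Dz|nDz] := pselect (D z); [by left|right; split => //].
  by move=> /interior_subset.
have bdD z : boundary D z -> ~ D z.
  by move=> [_ niz] Dz; apply: niz; exact: open_nbhs_nbhs.
have dist1 z w : closure D z -> D w -> cabs (z - w) <= 1.
  exact: closure_diameter_le.
have [d /andP[d0 d1] dsep] := @fin_lower_bound R ('I_s * 'I_s)%type
  (fun p => if p.1 == p.2 then 1 else cabs (lam p.1 - lam p.2) / 2)
  ltac:(by move=> [i j] /=; case: eqVneq => // ij;
    rewrite divr_gt0// cabs_gt0 subr_eq0 (inj_eq lam_inj)).
have sep i j : i != j -> 2 * d <= cabs (lam i - lam j).
  by move=> ij; have := dsep (i, j); rewrite /= (negbTE ij); lra.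
have loc i : exists p : (R[i] -> R[i]) * R * R, [/\ 0 < p.1.2, 0 < p.2 &
    forall z, cabs (z - lam i) < p.2 -> [/\ cdiff p.1.1 z, p.1.2 <= cabs (p.1.1 z), D z &
      z != lam i -> f z = p.1.1 z / (z - lam i) ^+ m i]].
  by have [g [c [e H]]] := pole_local oD (lamD i) (orderf i); exists (g, c, e).
have [p Hp] := choice loc.
pose g i := (p i).1.1.
have [c /andP[c0 c1] cle] := @fin_lower_bound R 'I_s (fun i => (p i).1.2)
  (fun i => let: And3 H _ _ := Hp i in H).
have [e /andP[e0 e1] ele] := @fin_lower_bound R 'I_s (fun i => (p i).2)
  (fun i => let: And3 _ H _ := Hp i in H).
(* The bound by [d] keeps the discs away from the other poles, and [rho < e] keeps them inside the
   domains of the local factors [g i]. *)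
pose rho := Num.min d (e / 2).
have rho0 : 0 < rho by rewrite lt_min d0 divr_gt0.
have rhod : rho <= d by rewrite ge_min lexx.
have rhoe : rho < e by rewrite gt_min; apply/orP; right; lra.
have gloc i z : cabs (z - lam i) <= rho -> [/\ cdiff (g i) z, c <= cabs (g i z), D z &
      z != lam i -> f z = g i z / (z - lam i) ^+ m i].
  move=> zi; have [_ _ /(_ z)] := Hp i; case.
    by apply: le_lt_trans zi _; apply: lt_le_trans rhoe (ele i).
  by move=> ? H ? ?; split => //; exact: le_trans (cle i) H.
have lam_sep i j z : i != j -> cabs (z - lam i) <= rho -> rho <= cabs (z - lam j).
  move=> ij zi; have := sep i j ij; have := cabsD (lam i - z) (z - lam j).
  by rewrite addrA subrK (cabsBC (lam i)); lra.
pose q : {poly R[i]} := \prod_i ('X - (lam i)%:P) ^+ m i.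
pose qo i : {poly R[i]} := \prod_(j | j != i) ('X - (lam j)%:P) ^+ m j.
have qE i z : q.[z] = (z - lam i) ^+ m i * (qo i).[z].
  by rewrite /q (bigD1 i)//= hornerM horner_exp hornerXsubC.
have qo_ge i z : cabs (z - lam i) <= rho -> rho ^+ N <= cabs (qo i).[z].
  move=> zi; rewrite horner_prod cabs_prod.
  apply: (@le_trans _ _ (\prod_(j | j != i) cabs (z - lam j) ^+ m j)); last first.
    rewrite le_eqVlt; apply/orP; left; apply/eqP; apply: eq_bigr => j _.
    by rewrite horner_exp hornerXsubC cabsX.
  apply: le_trans (@prod_expr_ge R _ _ _ _ m rho (ltW rho0) _).
    rewrite ler_wiXn2l ?(ltW rho0) ?(le_trans rhod)//.
    by rewrite /N [leqRHS](bigD1 i)//= leq_addl.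
  by move=> j ji; apply: lam_sep zi; rewrite eq_sym.
have q1 z : closure D z -> cabs q.[z] <= 1.
  move=> cz; rewrite horner_prod cabs_prod.
  apply: (@le_trans _ _ (\prod_i cabs (z - lam i) ^+ m i)).
    rewrite le_eqVlt; apply/orP; left; apply/eqP; apply: eq_bigr => j _.
    by rewrite horner_exp hornerXsubC cabsX.
  apply: le_trans (@prod_expr_le R _ _ _ _ m 1 _) _; last by rewrite expr1n.
  by move=> j _; rewrite cabs_ge0 dist1.
(* [F] is [f q] with its removable singularities at the poles filled in. *)
pose F z := if [pick i | z == lam i] is Some i then g i z * (qo i).[z] else f z * q.[z].
have Flam i z : cabs (z - lam i) <= rho -> F z = g i z * (qo i).[z].
  move=> zi; rewrite /F; case: pickP => [j /eqP zj|zN].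
    have [->//|ij] := eqVneq i j.
    by have := lam_sep _ _ _ ij zi; rewrite zj subrr cabs0 leNgt rho0.
  have [_ _ _ ->] := gloc i z zi; last by rewrite zN.
  by rewrite (qE i); field; rewrite expf_neq0// subr_eq0 zN.
have FN z : (forall i, z != lam i) -> F z = f z * q.[z].
  by move=> zN; rewrite /F; case: pickP => // i; rewrite (negbTE (zN i)).
have near_lam i : \forall z \near lam i, cabs (z - lam i) <= rho.
  by apply/nbhs_cabsP; exists rho => // z /ltW.
(* Three cases: at a pole the filled-in product is used; elsewhere in [D] the function [f] is
   holomorphic, its only poles being the [lam i]; on the boundary [holf] applies. *)
have dF z : closure D z -> cdiff F z.
  move=> cz; have [[i zi]|zN] := pselect (exists i, z = lam i).
    apply: (@cdiff_near _ (fun z => g i z * (qo i).[z])).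
      by rewrite zi; apply: filterS (near_lam i) => w /Flam.
    apply: cdiffM; last exact: cdiff_horner.
    by have [] := gloc i z; rewrite // zi subrr cabs0 ltW.
  have {}zN i : z != lam i by apply/eqP => zi; apply: zN; exists i.
  have [b /andP[b0 _] Hb] := @fin_lower_bound R 'I_s (fun i => cabs (z - lam i))
    ltac:(by move=> i; rewrite cabs_gt0 subr_eq0).
  apply: (@cdiff_near _ (fun z => f z * q.[z])).
    apply/nbhs_cabsP; exists b => // w wz; rewrite FN// => i.
    by apply: contraTneq wz => ->; rewrite -leNgt cabsBC.
  apply: cdiffM; last exact: cdiff_horner.
  have [Dz|bz] := clD z cz.
    have [/holomorphic_at_near[b' b'0]|pz] := merof z Dz.
      by apply; rewrite subrr cabs0.
    have : range lam z by rewrite -polesf.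
    by move=> [i _ zi]; have := zN i; rewrite zi eqxx.
  have [U [oU bU hU]] := holf.
  by apply/cdiffP; exact: hU (bU _ bz).
have [C1 C10 hermite] := hermite_remainder rho0 lam_sep (erefl N).
(* The diameter gives [cabs z <= cabs z0 + 1] on [D]; the extra 1 leaves room for the test points of
   [root_count]. *)
pose B := cabs z0 + 2.
have DB z : D z -> cabs z + 1 <= B.
  move=> Dz; have := dist1 z z0 (subset_closure Dz) Dz0.
  by have := cabsD (z - z0) z0; rewrite subrK /B; lra.
have B0 : 0 <= B by rewrite addr_ge0// cabs_ge0.
have [eps0 eps00 count_roots] := @root_count R s lam m N d B (erefl N) m_gt0 d0 d1 sep
  (fun i j => dist1 _ _ (subset_closure (lamD i)) (lamD j)) (fun i => DB _ (lamD i)).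
have cr0 : 0 < c * rho ^+ N by rewrite mulr_gt0// exprn_gt0.
pose A := C1 / (c * rho ^+ N).
have A0 : 0 <= A by rewrite divr_ge0// ltW.
pose NB := N%:R * B ^+ N.
have NB0 : 0 <= NB by rewrite mulr_ge0// exprn_ge0.
have dN0 : 0 < d ^+ N by exact: exprn_gt0.
have ANd0 : 0 <= A * NB / d ^+ N by rewrite divr_ge0 ?(ltW dN0)// mulr_ge0.
(* The coefficients of the remainder will be at most [A * gamma n]. The first two terms of [C] yield
   the two smallness conditions of [root_count], and the last makes [C] positive. *)
pose C := 2 * A + A * NB / d ^+ N + 1.
have C0 : 0 < C by rewrite /C; lra.
exists eps0, C; split => // eps n /andP[epsp epsle] gam_le i.
have [rs [Qo [rsD rE QoN npolesE]]] := ratfun_split D (r n).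
set Q := \prod_(z <- rs) _ in rE.
have Qo0 z : closure D z -> Qo.[z] != 0.
  move=> /clD[|bz]; first exact: QoN.
  have [rz _] := supnorm_diff_le (rn_approx n) bz.
  by move: rz; rewrite rE hornerM mulf_eq0 negb_or => /andP[].
pose P z := (rnum (r n)).[z] / Qo.[z].
have dP z : closure D z -> cdiff P z.
  move=> /Qo0 Qz; apply: cdiffM; first exact: cdiff_horner.
  by apply: cdiffV => //; exact: cdiff_horner.
have Phi z : closure D z -> cabs (F z * Q.[z] - q.[z] * P z) <= gamma n.
  apply: (@maximum_modulus R (closure D) (fun z => F z * Q.[z] - q.[z] * P z)).
  - by apply: compact_closure_diameter => //; exists z0.
  - move=> w cw; apply/cdiffP; apply: cdiffB; apply: cdiffM.
    + exact: dF.
    + exact: cdiff_horner.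
    + exact: cdiff_horner.
    + exact: dP.
  move=> w cw niw; have bw : boundary D w by case: (clD w cw) => // /DintD.
  have [rw fw] := supnorm_diff_le (rn_approx n) bw.
  have Qw : Q.[w] != 0 by move: rw; rewrite rE hornerM mulf_eq0 negb_or => /andP[].
  rewrite FN; last by move=> j; apply/eqP => wj; apply: (bdD w bw); rewrite wj.
  have -> : f w * q.[w] * Q.[w] - q.[w] * P w = q.[w] * Q.[w] * (f w - rateval (r n) w).
    by rewrite /rateval rE hornerM /P; field; rewrite Qw Qo0.
  rewrite !cabsM -[leRHS]mul1r ler_pM ?mulr_ge0 ?cabs_ge0//.
  rewrite mulr_ile1 ?cabs_ge0 ?q1//; apply: cabs_prod_XsubC_le1 => x /rsD Dx.
  exact: dist1.
(* The sign of [gamma n] is not assumed; it is read off from the bound at one point of [D]. *)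
have gam0 : 0 <= gamma n by apply: le_trans (Phi z0 (subset_closure Dz0)); exact: cabs_ge0.
pose gam := gamma n / (c * rho ^+ N).
(* On the disc around [lam j], dividing [F Q - q P] by [F = g j * qo j], whose modulus is at least
   [c * rho ^+ N], leaves [Q] minus a multiple of [(z - lam j) ^+ m j]. *)
have [|||U [T [QE sT bT]]] := hermite Q (fun i z => P z / g i z) gam.
- by rewrite divr_ge0// ltW.
- move=> j z zj; have [dg cg Dz _] := gloc j z zj.
  apply: cdiffM; first by apply: dP; exact: subset_closure.
  by apply: cdiffV => //; rewrite -cabs_gt0 (lt_le_trans c0).
- move=> j z zj; have [dg cg Dz _] := gloc j z zj.
  have gz : g j z != 0 by rewrite -cabs_gt0 (lt_le_trans c0).
  have qz : (qo j).[z] != 0 by rewrite -cabs_gt0 (lt_le_trans _ (qo_ge j z zj))// exprn_gt0.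
  have -> : Q.[z] - (z - lam j) ^+ m j * (P z / g j z) =
      (F z * Q.[z] - q.[z] * P z) / (g j z * (qo j).[z]).
    by rewrite (Flam j z zj) (qE j); field; rewrite gz qz.
  rewrite cabsM cabsV /gam ler_pM ?cabs_ge0 ?invr_ge0 ?cabs_ge0//.
    exact/Phi/subset_closure.
  have gq : c * rho ^+ N <= cabs (g j z * (qo j).[z]).
    by rewrite cabsM; apply: ler_pM (ltW c0) _ cg (qo_ge j z zj); exact: exprn_ge0 (ltW rho0).
  by rewrite lef_pV2// posrE (lt_le_trans cr0).
(* This turns the bound on the number of poles into the degree bound on [Q] required by
   [root_count]. *)
have npolesD : npoles (r n) D = size rs.
  rewrite npolesE//; apply/eqP; rewrite -all_count; apply/allP => z /rsD Dz.
  exact: mem_set.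
have etaE k : cabs T`_k <= A * gamma n.
  by apply: le_trans (bT k) _; rewrite /gam /A mulrA mulrAC.
have gC : gamma n * C <= eps by rewrite -ler_pdivlMr// mulrC.
have Ag : 0 <= A * gamma n by rewrite mulr_ge0.
have NBg : 0 <= A * NB / d ^+ N * gamma n by rewrite mulr_ge0.
have CE : gamma n * C = 2 * (A * gamma n) + A * NB / d ^+ N * gamma n + gamma n.
  by rewrite /C; ring.
rewrite npolesE; last by move=> z [].
apply: etrans (count_roots rs U T (A * gamma n) eps _ _ QE sT etaE _ _ _ i).
- by apply: eq_in_count => z /rsD Dz; rewrite Lambda_memE.
- by rewrite -npolesD; apply: leq_trans (mt_le n); have [] := rn_class n.
- by move=> z /rsD /DB; lra.
- by rewrite epsp.
- lra.
- have -> : A * gamma n * (N%:R * B ^+ N) = d ^+ N * (A * NB / d ^+ N * gamma n).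
    by rewrite /NB; field; rewrite gt_eqF.
  by rewrite ler_pM2l//; lra.
Qed.
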